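(* Let $\mathcal{L}\in\mathscr{H}(d)$ satisfy $\mathcal{L}(I_d)=0$ and $\mathrm{tr}(\mathcal{L}(X))=0$ for all $X\in M_d$. The following are equivalent: (i) $e^{t\mathcal{L}}$ is a mixed unitary channel for every $t\ge0$; (ii) $\mathcal{L}$ belongs to the closed convex cone generated by $\{\mathrm{Ad}_U-\mathrm{id}:U\in\mathbb{U}(d)\}$; (iii) $\langle\Gamma,\mathcal{L}\rangle\ge0$ for all $\Gamma\in\mathscr{D}(d)$.
   Context: $\mathrm{Ad}_U(X)=U^*XU$; $\mathbb{U}(d)$ is the unitary group of $M_d$. A mixed unitary channel is a map $\sum_{j=1}^\ell\lambda_j\mathrm{Ad}_{U_j}$ with $U_j\in\mathbb{U}(d)$, $\lambda_j\ge0$, $\sum_j\lambda_j=1$. $\mathscr{H}(d)$ is the real vector space of Hermitian-preserving linear maps on $M_d$. Choi matrix $\mathscr{J}(\Phi)=(\mathrm{id}\otimes\Phi)(|\Omega_d\rangle\langle\Omega_d|)$, $\Omega_d=d^{-1/2}\sum_j e_j\otimes e_j$; inner product $\langle\Phi,\Psi\rangle=\mathrm{tr}(\mathscr{J}(\Phi)^*\mathscr{J}(\Psi))$. $\mathscr{W}(d)$ is the set of unital, trace-preserving elements of $\mathscr{H}(d)$, and $\mathscr{D}(d)=\{\Gamma\in\mathscr{W}(d):\langle\mathrm{id},\Gamma\rangle=0,\ \langle\mathrm{Ad}_U,\Gamma\rangle\ge0\ \forall U\in\mathbb{U}(d)\}$. *)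

(* Defs.v *)
From HB Require Import structures.
From mathcomp Require Import all_boot all_order all_algebra.
From mathcomp Require Import complex mxtens.
Set Implicit Arguments. Unset Strict Implicit. Unset Printing Implicit Defensive.
Import Order.TTheory GRing.Theory Num.Theory.
Local Open Scope ring_scope.
Local Open Scope complex_scope.

Definition adjmx (R : rcfType) (m n : nat) (X : 'M[R[i]]_(m, n)) : 'M[R[i]]_(n, m) :=
  (map_mx (@conjc R) X)^T.

Definition unitary_mx (R : rcfType) (d : nat) (U : 'M[R[i]]_d) : Prop :=
  adjmx U *m U = 1%:M /\ U *m adjmx U = 1%:M.

Definition Ad (R : rcfType) (d : nat) (U : 'M[R[i]]_d) (X : 'M[R[i]]_d) : 'M[R[i]]_d :=
  adjmx U *m X *m U.

Definition linear_map (R : rcfType) (d : nat) (Phi : 'M[R[i]]_d -> 'M[R[i]]_d) : Prop :=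
  forall (a : R[i]) (X Y : 'M[R[i]]_d), Phi (a *: X + Y) = a *: Phi X + Phi Y.

Definition herm_preserving (R : rcfType) (d : nat) (Phi : 'M[R[i]]_d -> 'M[R[i]]_d) : Prop :=
  forall X : 'M[R[i]]_d, adjmx X = X -> adjmx (Phi X) = Phi X.

Definition in_H (R : rcfType) (d : nat) (Phi : 'M[R[i]]_d -> 'M[R[i]]_d) : Prop :=
  linear_map Phi /\ herm_preserving Phi.

(* Choi matrix J(Φ) = (id ⊗ Φ)(|Ω_d><Ω_d|) = d^{-1} Σ_{i,j} E_ij ⊗ Φ(E_ij) *)
Definition choi (R : rcfType) (d : nat) (Phi : 'M[R[i]]_d -> 'M[R[i]]_d) : 'M[R[i]]_(d * d) :=
  (d%:R)^-1 *: \sum_(i < d) \sum_(j < d) (delta_mx i j *t Phi (delta_mx i j)).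

Definition hs_ip (R : rcfType) (d : nat) (Phi Psi : 'M[R[i]]_d -> 'M[R[i]]_d) : R[i] :=
  \tr (adjmx (choi Phi) *m choi Psi).

Definition in_W (R : rcfType) (d : nat) (G : 'M[R[i]]_d -> 'M[R[i]]_d) : Prop :=
  in_H G /\ G 1%:M = 1%:M /\ forall X, \tr (G X) = \tr X.

Definition in_D (R : rcfType) (d : nat) (G : 'M[R[i]]_d -> 'M[R[i]]_d) : Prop :=
  in_W G /\ hs_ip id G = 0 /\
  forall U : 'M[R[i]]_d, unitary_mx U -> 0 <= hs_ip (Ad U) G.

Definition mixed_unitary (R : rcfType) (d : nat) (Phi : 'M[R[i]]_d -> 'M[R[i]]_d) : Prop :=
  exists (l : nat) (lam : 'I_l -> R) (U : 'I_l -> 'M[R[i]]_d),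
    (forall j, 0 <= lam j) /\ \sum_(j < l) lam j = 1 /\
    (forall j, unitary_mx (U j)) /\
    forall X, Phi X = \sum_(j < l) (lam j)%:C *: Ad (U j) X.

Definition mx_cvg (R : rcfType) (m n : nat) (u : nat -> 'M[R[i]]_(m, n)) (l : 'M[R[i]]_(m, n)) : Prop :=
  forall e : R, 0 < e -> exists N : nat, forall k : nat, (N <= k)%N ->
    forall a b, `|u k a b - l a b| < e%:C.

Definition is_expmap (R : rcfType) (d : nat) (L : 'M[R[i]]_d -> 'M[R[i]]_d) (t : R)
  (E : 'M[R[i]]_d -> 'M[R[i]]_d) : Prop :=
  forall X : 'M[R[i]]_d,
    mx_cvg (fun n : nat => \sum_(k < n) ((t%:C) ^+ k / (k`!)%:R) *: iter k L X) (E X).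

Definition in_unitary_cone (R : rcfType) (d : nat) (K : 'M[R[i]]_d -> 'M[R[i]]_d) : Prop :=
  exists (l : nat) (c : 'I_l -> R) (U : 'I_l -> 'M[R[i]]_d),
    (forall j, 0 <= c j) /\ (forall j, unitary_mx (U j)) /\
    forall X, K X = \sum_(j < l) (c j)%:C *: (Ad (U j) X - X).

(* L lies in the closure of that cone (sequential closure; the space of linear
   maps on M_d is finite-dimensional, so pointwise convergence = norm convergence) *)
Definition in_closed_unitary_cone (R : rcfType) (d : nat) (L : 'M[R[i]]_d -> 'M[R[i]]_d) : Prop :=
  exists Ks : nat -> ('M[R[i]]_d -> 'M[R[i]]_d),
    (forall n, in_unitary_cone (Ks n)) /\
    forall X : 'M[R[i]]_d, mx_cvg (fun n => Ks n X) (L X).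

(* Main.v *)
(** The equivalence (i) <-> (ii) is a differentiation / product-formula argument: the difference
   quotients [n (e^(L/n) - id)] lie in the cone and converge to [L]; conversely, if cone elements [K]
   converge to [L], then [(id + t K / m)^m] is mixed unitary for [m] large and converges to [e^(tL)],
   and the mixed unitary maps form a closed set because Caratheodory's theorem bounds the number of
   unitaries needed, so that weights and unitaries converge along an ultrafilter.

   For (iii) -> (ii), if [L] is outside the closed cone and [P] is its nearest point there, then
   [G0 = P - L] satisfies [<G0, Ad_U - id> >= 0] and [<G0, L> < 0]. Averaging [Ad_U] over the signed
   cyclic shifts gives the completely depolarizing map, orthogonal to [G0], so [<G0, id> <= 0].
   Perturbing by a small multiple of [depol - id] makes this strict, and then a suitable
   [depol + s (G0 + e (depol - id))] lies in D(d) and is negative on [L]. *)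
Require Import Defs.
From HB Require Import structures.
From mathcomp Require Import all_boot all_order all_algebra.
From mathcomp Require Import complex mxtens.
From mathcomp Require Import all_classical.
From mathcomp Require Import reals topology normedtype sequences.
From mathcomp Require Import ring lra.
Set Implicit Arguments. Unset Strict Implicit. Unset Printing Implicit Defensive.
Import Order.TTheory GRing.Theory Num.Theory.
Import numFieldNormedType.Exports Normc.
Local Open Scope classical_set_scope.
Local Open Scope ring_scope.
Local Open Scope complex_scope.

Local Notation Re := complex.Re.
Local Notation Im := complex.Im.

(** * Linear maps on matrices in coordinates, with entrywise norms *)

Section LinearMaps.
Variables (R : realType) (d : nat).
Implicit Types (X Y : 'M[R[i]]_d) (Phi Psi : 'M[R[i]]_d -> 'M[R[i]]_d).

Definition lin_of Phi (h : linear_map Phi) : {linear 'M[R[i]]_d -> 'M[R[i]]_d} :=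
  HB.pack Phi (GRing.isLinear.Build _ _ _ _ Phi h).

Lemma linear_mapD Phi : linear_map Phi -> forall X Y, Phi (X + Y) = Phi X + Phi Y.
Proof. move=> h; exact: (linearD (lin_of h)). Qed.

Lemma linear_mapB Phi : linear_map Phi -> forall X Y, Phi (X - Y) = Phi X - Phi Y.
Proof. move=> h; exact: (linearB (lin_of h)). Qed.

Lemma linear_mapZ Phi : linear_map Phi -> forall (a : R[i]) X, Phi (a *: X) = a *: Phi X.
Proof. move=> h; exact: (linearZ_LR (lin_of h)). Qed.

Lemma linear_map_sum Phi (I : Type) (r : seq I) (P : pred I) (F : I -> 'M[R[i]]_d) :
  linear_map Phi -> Phi (\sum_(i <- r | P i) F i) = \sum_(i <- r | P i) Phi (F i).
Proof. move=> h; exact: (linear_sum (lin_of h)). Qed.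

Definition quad := (('I_d * 'I_d) * ('I_d * 'I_d))%type.
(** Up to the factor [1/d] and a reindexing, these coefficients are the entries of the Choi
    matrix. *)
Definition ent Phi (q : quad) : R[i] := Phi (delta_mx q.1.1 q.1.2) q.2.1 q.2.2.

Lemma linear_mapE Phi : linear_map Phi -> forall X a b,
  Phi X a b = \sum_p X p.1 p.2 * ent Phi (p, (a, b)).
Proof.
move=> h X a b; rewrite {1}[X]matrix_sum_delta pair_bigA /= linear_map_sum //.
rewrite summxE; apply: eq_bigr => p _.
by rewrite linear_mapZ // mxE.
Qed.

Definition nrm X : R := \sum_p normc (X p.1 p.2).
(** An upper bound for the operator norm induced by [nrm], not that norm itself. It is small as soon
    as all coefficients are small, which suits pointwise limits. *)
Definition opn Phi : R := \sum_q normc (ent Phi q).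

Lemma normc_ge0 (z : R[i]) : 0 <= normc z.
Proof. by case: z => a b; exact: sqrtr_ge0. Qed.

Lemma normc_sum (I : Type) (r : seq I) (P : pred I) (F : I -> R[i]) :
  normc (\sum_(i <- r | P i) F i) <= \sum_(i <- r | P i) normc (F i).
Proof.
elim/big_rec2: _ => [|i x y _ h]; first by rewrite normc0.
exact: le_trans (le_normcD _ _) (lerD (lexx _) h).
Qed.

Lemma nrm_ge0 X : 0 <= nrm X. Proof. by apply: sumr_ge0 => p _; exact: normc_ge0. Qed.

Lemma opn_ge0 Phi : 0 <= opn Phi. Proof. by apply: sumr_ge0 => p _; exact: normc_ge0. Qed.

Lemma nrmD X Y : nrm (X + Y) <= nrm X + nrm Y.
Proof. by rewrite -big_split; apply: ler_sum => p _; rewrite mxE; exact: le_normcD. Qed.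

Lemma nrmZ (a : R[i]) X : nrm (a *: X) = normc a * nrm X.
Proof. by rewrite mulr_sumr; apply: eq_bigr => p _; rewrite mxE normcM. Qed.

Lemma nrm0 : nrm 0 = 0.
Proof. by apply: big1 => p _; rewrite mxE normc0. Qed.

Lemma nrm_sum (I : Type) (r : seq I) (P : pred I) (F : I -> 'M[R[i]]_d) :
  nrm (\sum_(i <- r | P i) F i) <= \sum_(i <- r | P i) nrm (F i).
Proof.
elim/big_rec2: _ => [|i x y _ h]; first by rewrite nrm0.
exact: le_trans (nrmD _ _) (lerD (lexx _) h).
Qed.

Lemma normc_le_nrm X a b : normc (X a b) <= nrm X.
Proof.
by rewrite /nrm (bigD1 (a, b)) //= lerDl; apply: sumr_ge0 => p _; exact: normc_ge0.
Qed.

Lemma nrm_le Phi X : linear_map Phi -> nrm (Phi X) <= opn Phi * nrm X.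
Proof.
move=> h; rewrite /opn -(pair_bigA _ (fun p r => normc (ent Phi (p, r)))) /= exchange_big mulr_suml.
apply: ler_sum => -[a b] _; rewrite linear_mapE //=.
apply: le_trans (normc_sum _ _ _) _; rewrite mulr_suml.
apply: ler_sum => p _; rewrite normcM mulrC; apply: ler_wpM2l; first exact: normc_ge0.
by case: p => i j; exact: (normc_le_nrm X).
Qed.

Lemma nrm_iter Phi k X : linear_map Phi -> nrm (iter k Phi X) <= opn Phi ^+ k * nrm X.
Proof.
move=> h; elim: k => [|k IH] /=; first by rewrite expr0 mul1r.
by rewrite exprS -mulrA; apply: le_trans (nrm_le _ h) _; rewrite ler_wpM2l // opn_ge0.
Qed.

Lemma normc_real (x : R) : normc x%:C = `|x|.
Proof. by rewrite /= expr0n /= addr0 sqrtr_sqr. Qed.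

Lemma normcB (x y : R[i]) : normc (x - y) = normc (y - x).
Proof. by rewrite -normcN opprB. Qed.

Lemma ge_normc_Re (z : R[i]) : `|Re z| <= normc z.
Proof. by rewrite -lecR; exact: normc_ge_Re. Qed.

Lemma ge_normc_Im (z : R[i]) : `|Im z| <= normc z.
Proof.
case: z => a b /=; rewrite -sqrtr_sqr; apply: ler_wsqrtr.
by rewrite lerDr sqr_ge0.
Qed.

Lemma normc_le_ReIm (z : R[i]) : normc z <= `|Re z| + `|Im z|.
Proof.
case: z => a b /=; rewrite -[leRHS]ger0_norm ?addr_ge0 // -sqrtr_sqr.
by apply: ler_wsqrtr; rewrite sqrrD !real_normK ?num_real // lerD2r lerDl mulrn_wge0 // mulr_ge0.
Qed.

(** The modulus on [R[i]] takes values in [R[i]]; estimates are carried out with the real-valued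
    [normc] instead. *)
Lemma mx_cvgP m n (u : nat -> 'M[R[i]]_(m, n)) l :
  mx_cvg u l <-> forall e : R, 0 < e -> exists N : nat, forall k : nat, (N <= k)%N ->
    forall a b, normc (u k a b - l a b) < e.
Proof.
split=> h e /h[N HN]; exists N => k Nk a b.
  by have := HN k Nk a b; rewrite -[`|_|]/((normc _)%:C) ltcR.
by rewrite -[`|_|]/((normc _)%:C) ltcR; exact: HN.
Qed.

End LinearMaps.

(** * Convergence of complex sequences along a filter *)

Section FilterLimits.
Variables (R : realType).
Implicit Types (F : set_system nat) (u v : nat -> R[i]).

(** Splitting into real and imaginary parts reduces every limit to the topology of the reals. The
    filter is a parameter because limits are taken both along [\oo] and along an ultrafilter
    refining it. *)
Definition clim F u (l : R[i]) :=
  ((fun n => Re (u n)) @ F --> Re l) /\ ((fun n => Im (u n)) @ F --> Im l).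

Lemma clim_cst F (c : R[i]) : Filter F -> clim F (fun=> c) c.
Proof. by move=> FF; split; exact: cvg_cst. Qed.

Lemma climD F u v a b : Filter F -> clim F u a -> clim F v b ->
  clim F (fun n => u n + v n) (a + b).
Proof.
move=> FF [u1 u2] [v1 v2]; split.
  rewrite raddfD; under eq_fun do rewrite raddfD; exact: cvgD.
rewrite raddfD; under eq_fun do rewrite raddfD; exact: cvgD.
Qed.

Lemma climM F u v a b : Filter F -> clim F u a -> clim F v b ->
  clim F (fun n => u n * v n) (a * b).
Proof.
have ReM (x y : R[i]) : Re (x * y) = Re x * Re y - Im x * Im y by case: x; case: y.
have ImM (x y : R[i]) : Im (x * y) = Re x * Im y + Im x * Re y by case: x; case: y.
move=> FF [u1 u2] [v1 v2]; split.
  rewrite ReM; under eq_fun do rewrite ReM; apply: cvgB; exact: cvgM.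
rewrite ImM; under eq_fun do rewrite ImM; apply: cvgD; exact: cvgM.
Qed.

Lemma climJ F u a : Filter F -> clim F u a -> clim F (fun n => conjc (u n)) (conjc a).
Proof.
have ImJ (x : R[i]) : Im (conjc x) = - Im x by case: x.
have ReJ (x : R[i]) : Re (conjc x) = Re x by case: x.
move=> FF [u1 u2]; split.
  by rewrite ReJ; under eq_fun do rewrite ReJ.
rewrite ImJ; under eq_fun do rewrite ImJ; exact: cvgN.
Qed.

Lemma climN F u a : Filter F -> clim F u a -> clim F (fun n => - u n) (- a).
Proof.
move=> FF /(climM FF (clim_cst (-1) FF)).
by rewrite mulN1r; under eq_fun do rewrite mulN1r.
Qed.

Lemma climB F u v a b : Filter F -> clim F u a -> clim F v b ->
  clim F (fun n => u n - v n) (a - b).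
Proof. by move=> FF hu hv; apply: climD => //; apply: climN. Qed.

Lemma clim_sum F (I : Type) (r : seq I) (P : pred I) (f : I -> nat -> R[i]) (l : I -> R[i]) :
  Filter F -> (forall i, P i -> clim F (f i) (l i)) ->
  clim F (fun n => \sum_(i <- r | P i) f i n) (\sum_(i <- r | P i) l i).
Proof.
move=> FF h; elim: r => [|i r IH].
  by rewrite big_nil; under eq_fun do rewrite big_nil; exact: clim_cst.
rewrite big_cons; under eq_fun do rewrite big_cons.
by case: ifP => // Pi; apply: climD => //; exact: h.
Qed.

Lemma clim_uniq F u a b : ProperFilter F -> clim F u a -> clim F u b -> a = b.
Proof.
move=> FF [u1 u2] [v1 v2]; apply/eqP; rewrite eq_complex.
by rewrite (cvg_unique (@Rhausdorff R) u1 v1) (cvg_unique (@Rhausdorff R) u2 v2) !eqxx.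
Qed.

Lemma clim_sub F G u a : F `<=` G -> clim F u a -> clim G u a.
Proof.
by move=> FG [u1 u2]; split=> A /= ?; apply: FG; [exact: u1|exact: u2].
Qed.

(** Compactness of the segment gives a cluster point of the image filter. For an ultrafilter a
    cluster point is a limit, since a set or its complement is always a member. This replaces the
    extraction of subsequences. *)
Lemma ultra_cvg F (f : nat -> R) (B : R) : UltraFilter F ->
  (forall n, `|f n| <= B) -> exists l : R, f @ F --> l.
Proof.
move=> UF hB.
have FfB : (f @ F) `[- B, B]%classic.
  by apply: (@filterE _ F) => n; rewrite /= in_itv /= -ler_norml.
have [l [_ cl]] := segment_compact (fmap_proper_filter f _) FfB.
exists l => A Al; have [//|FA] := in_ultra_setVsetC (f @^-1` A) UF.
by have [x []] := cl (~` A) A FA Al.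
Qed.


Lemma clim_bounded F u (B : R) : UltraFilter F ->
  (forall n, normc (u n) <= B) -> exists l, clim F u l.
Proof.
move=> UF hB.
have [a ha] := ultra_cvg UF (fun n => le_trans (ge_normc_Re (u n)) (hB n)).
have [b hb] := ultra_cvg UF (fun n => le_trans (ge_normc_Im (u n)) (hB n)).
by exists (a +i* b).
Qed.

Lemma clim_eventually u l : clim \oo u l <->
  forall e : R, 0 < e -> exists N : nat, forall k : nat, (N <= k)%N -> normc (u k - l) < e.
Proof.
split.
  move=> [/cvgrPdist_lt h1 /cvgrPdist_lt h2] e e0.
  have e2 : 0 < e / 2 by rewrite divr_gt0.
  have [N1 _ H1] := h1 _ e2; have [N2 _ H2] := h2 _ e2.
  exists (maxn N1 N2) => k; rewrite geq_max => /andP[k1 k2].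
  apply: le_lt_trans (normc_le_ReIm _) _.
  rewrite [e]splitr !raddfB /=.
  by apply: ltrD; rewrite distrC; [exact: H1|exact: H2].
move=> h; split; apply/cvgrPdist_lt => e /h[N HN]; exists N => // k /= Nk.
  rewrite distrC -raddfB; exact: le_lt_trans (ge_normc_Re _) (HN k Nk).
rewrite distrC -raddfB; exact: le_lt_trans (ge_normc_Im _) (HN k Nk).
Qed.

Lemma mx_cvg_clim m n (u : nat -> 'M[R[i]]_(m, n)) l : mx_cvg u l <->
  forall a b, clim \oo (fun k => u k a b) (l a b).
Proof.
rewrite mx_cvgP; split.
  by move=> h a b; apply/clim_eventually => e /h[N HN]; exists N => k /HN.
move=> h e e0.
have /choice[N HN] : forall p : 'I_m * 'I_n, exists N : nat, forall k, (N <= k)%N ->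
    normc (u k p.1 p.2 - l p.1 p.2) < e.
  by move=> p; have /clim_eventually := h p.1 p.2; exact.
exists (\max_p N p) => k hk a b; apply: (HN (a, b)).
by apply: leq_trans hk; apply: leq_bigmax.
Qed.

End FilterLimits.

(** * The exponential series and its approximation by powers of [id + (t/m) K] *)

Section Exponential.
Variables (R : realType) (d : nat).
Implicit Types (X Y : 'M[R[i]]_d) (L K : 'M[R[i]]_d -> 'M[R[i]]_d).

Lemma exp_sum_le (x : R) n : 0 <= x -> \sum_(k < n) x ^+ k / k`!%:R <= expR x.
Proof.
move=> x0; rewrite -(big_mkord xpredT (fun k => x ^+ k / k`!%:R)).
apply: (nondecreasing_cvgn_le _ (is_cvg_series_exp_coeff x) n).
by apply: nondecreasing_series => k _ _; rewrite exp_coeff_ge0.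
Qed.

Definition pexp L (t : R) n X : 'M[R[i]]_d :=
  \sum_(k < n) ((t%:C) ^+ k / (k`!)%:R) *: iter k L X.

Lemma exp_coeffC (t : R) k : (t%:C) ^+ k / (k`!)%:R = (t ^+ k / (k`!)%:R)%:C.
Proof. by rewrite rmorphM fmorphV rmorphXn rmorph_nat. Qed.

Lemma exp_coeff_ge (t : R) k : 0 <= t -> 0 <= t ^+ k / (k`!)%:R.
Proof. by move=> t0; rewrite divr_ge0 ?exprn_ge0. Qed.

Lemma series_cvg_of_le (u : nat -> R) (c x : R) : 0 <= x -> 0 <= c ->
  (forall k, `|u k| <= c * (x ^+ k / k`!%:R)) ->
  exists l : R, (fun n => \sum_(k < n) u k) @ \oo --> l.
Proof.
move=> x0 c0 hu; have : cvgn (series u).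
  apply: normed_cvg; apply: (@series_le_cvg _ _ (c *: exp_coeff x)) => //.
  - by move=> k; exact: normr_ge0.
  - by move=> k; apply: mulr_ge0 => //; exact: exp_coeff_ge0.
  - exact: is_cvg_seriesZ (is_cvg_series_exp_coeff x).
move=> /cvg_ex[l hl]; exists l; rewrite (_ : (fun n => _) = series u) //.
by apply/funext => n; rewrite /series /= big_mkord.
Qed.

(** The entries of the [k]-th term are at most [nrm X * (t * opn L) ^ k / k!] in modulus, so their
    real and imaginary parts converge by comparison with the real exponential series. *)
Lemma expmap_exists L t : linear_map L -> 0 <= t -> exists E, is_expmap L t E.
Proof.
move=> hL t0.
have H X (p : 'I_d * 'I_d) : exists l, clim \oo (fun n => pexp L t n X p.1 p.2) l.
  have hb k : normc (((t%:C) ^+ k / (k`!)%:R) * iter k L X p.1 p.2) <=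
      nrm X * ((t * opn L) ^+ k / k`!%:R).
    rewrite normcM exp_coeffC normc_real ger0_norm ?exp_coeff_ge //.
    have := le_trans (normc_le_nrm (iter k L X) p.1 p.2) (nrm_iter k X hL).
    move=> /(ler_wpM2l (exp_coeff_ge k t0)) /le_trans; apply.
    by rewrite exprMn le_eqVlt; apply/orP; left; apply/eqP; ring.
  have x0 := mulr_ge0 t0 (opn_ge0 L).
  have [a ha] := series_cvg_of_le x0 (nrm_ge0 X)
    (fun k => le_trans (ge_normc_Re _) (hb k)).
  have [b hb'] := series_cvg_of_le x0 (nrm_ge0 X)
    (fun k => le_trans (ge_normc_Im _) (hb k)).
  exists (a +i* b); split => /=.
    rewrite (_ : (fun n => _) = (fun n => \sum_(k < n)
      Re (((t%:C) ^+ k / (k`!)%:R) * iter k L X p.1 p.2))) //; apply/funext => n.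
    rewrite /pexp summxE raddf_sum /=; apply: eq_bigr => k _.
    by rewrite mxE.
  rewrite (_ : (fun n => _) = (fun n => \sum_(k < n)
    Im (((t%:C) ^+ k / (k`!)%:R) * iter k L X p.1 p.2))) //; apply/funext => n.
  rewrite /pexp summxE raddf_sum /=; apply: eq_bigr => k _.
  by rewrite mxE.
have /choice[e he] : forall Xp : 'M[R[i]]_d * ('I_d * 'I_d), exists l,
    clim \oo (fun n => pexp L t n Xp.1 Xp.2.1 Xp.2.2) l.
  by move=> [X p]; exact: H.
exists (fun X => \matrix_(a, b) e (X, (a, b))) => X.
by apply/mx_cvg_clim => a b; rewrite mxE; exact: (he (X, (a, b))).
Qed.

Lemma mx_cvg_le (u : nat -> 'M[R[i]]_d) (l c : 'M[R[i]]_d) N B : mx_cvg u l ->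
  (forall k, (N <= k)%N -> nrm (u k - c) <= B) ->
  forall a b, normc ((l - c) a b) <= B.
Proof.
move=> /mx_cvgP ul hB a b; apply/ler_addgt0Pr => e e0.
have [m hm] := ul e e0.
have h1 := hm _ (leq_maxr N m) a b.
have h2 := le_trans (normc_le_nrm _ a b) (hB _ (leq_maxl N m)).
have -> : (l - c) a b = (u (maxn N m) - c) a b + (l - u (maxn N m)) a b.
  by rewrite !mxE; ring.
apply: le_trans (le_normcD _ _) (lerD h2 _).
by rewrite 2!mxE normcB ltW.
Qed.

(** For [t <= 1] every term of order at least 2 contains [t ^ 2] times a factor at most 1; what
    remains is dominated by the exponential series at [opn L]. *)
Lemma expmap_first_order L t E X a b : linear_map L -> 0 <= t <= 1 -> is_expmap L t E ->
  normc ((E X - (X + t%:C *: L X)) a b) <= t ^+ 2 * (expR (opn L) * nrm X).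
Proof.
(* From two summands on, the terms of order 0 and 1 are present and cancel against
   [X + t%:C *: L X]. *)
move=> hL /andP[t0 t1] /(_ X) hE; apply: (mx_cvg_le (N := 2) hE) => -[|[|n]] // _.
rewrite 2!big_ord_recl /= expr0 expr1 !divr1 scale1r addrA [X + _ + _]addrC addrK.
apply: le_trans (nrm_sum _ _ _) _.
apply: (@le_trans _ _ (\sum_(k < n) t ^+ 2 * (opn L ^+ k.+2 / k.+2`!%:R * nrm X))).
  apply: ler_sum => k _; rewrite /bump /= !add1n exp_coeffC nrmZ normc_real ger0_norm ?exp_coeff_ge //.
  have := ler_wpM2l (exp_coeff_ge k.+2 t0) (nrm_iter k.+2 X hL); move=> /le_trans; apply.
  rewrite [t ^+ k.+2]exprS exprS.
  have : t ^+ k <= 1 by rewrite exprn_ile1.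
  set w := t ^+ k; set p := opn L ^+ _ => hw.
  have -> : t * (t * w) / k.+2`!%:R * (p * nrm X) = w * (t ^+ 2 * (p / k.+2`!%:R * nrm X)) by ring.
  by rewrite ler_piMl // mulr_ge0 ?sqr_ge0 // mulr_ge0 ?nrm_ge0 // exp_coeff_ge ?opn_ge0.
rewrite -mulr_sumr ler_wpM2l ?exprn_ge0 // -mulr_suml ler_wpM2r ?nrm_ge0 //.
apply: le_trans (exp_sum_le n.+2 (opn_ge0 L)).
rewrite !big_ord_recl /= addrA lerDr addr_ge0 //; last exact: (exp_coeff_ge 1 (opn_ge0 _)).
exact: (exp_coeff_ge 0 (opn_ge0 _)).
Qed.

Lemma iter_binomial K (c : R) m X : linear_map K ->
  iter m (fun Y => Y + c%:C *: K Y) X =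
  \sum_(k < m.+1) ('C(m, k)%:R * c ^+ k)%:C *: iter k K X.
Proof.
move=> hK; elim: m => [|m IH].
  by rewrite big_ord1 /= bin0 expr0 mulr1 scale1r.
rewrite iterS IH linear_map_sum // scaler_sumr.
transitivity (\sum_(k < m.+2) ('C(m, k)%:R * c ^+ k)%:C *: iter k K X +
    \sum_(k < m.+1) ('C(m, k)%:R * c ^+ k.+1)%:C *: iter k.+1 K X).
  congr (_ + _); first by rewrite [RHS]big_ord_recr /= bin_small // mul0r scale0r addr0.
  apply: eq_bigr => k _; rewrite linear_mapZ // scalerA -rmorphM /=.
  by congr (_%:C *: _); rewrite exprS; ring.
rewrite big_ord_recl [in RHS]big_ord_recl /= -addrA -big_split /= !bin0; congr (_ + _).
apply: eq_bigr => k _; rewrite /bump /= !add1n -scalerDl -rmorphD /= binS natrD.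
by congr (_%:C *: _); ring.
Qed.

(** The ratio is the product of [1 - j/m] over [j < k], and it measures how far the binomial
    coefficient of [(id + (t/m) K)^m] is from that of the exponential. Passing from [k] to [k + 1]
    loses at most [k/m], which [(k + 1)^2 - k^2] covers. *)
Lemma ffact_ratio (m k : nat) : (0 < m)%N -> (k <= m)%N ->
  1 - (k ^ 2)%N%:R / m%:R <= ((m ^_ k)%N%:R / m%:R ^+ k : R) <= 1.
Proof.
move=> m0; have m0' : 0 < m%:R :> R by rewrite ltr0n.
elim: k => [|k IH] km; first by rewrite expr0 divr1 mul0r subr0 lexx.
have /andP[h1 h2] := IH (ltnW km).
rewrite ffactnSr exprSr natrM invfM mulrACA natrB 1?ltnW // mulrBl divff ?gt_eqF //.
set r : R := _ / _ in h1 h2 *; set q : R := k%:R / m%:R.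
have q0 : 0 <= q by rewrite divr_ge0.
have r0 : 0 <= r by rewrite divr_ge0 ?exprn_ge0.
have q1 : q <= 1 by rewrite ler_pdivrMr // mul1r ler_nat ltnW.
have : (k.+1 ^ 2)%N%:R / m%:R = (k ^ 2)%N%:R / m%:R + q * 2 + m%:R^-1 :> R.
  by rewrite /q -addn1 sqrnD !natrD !natrM; ring.
have : 0 <= m%:R^-1 :> R by rewrite invr_ge0.
move=> w0 ->; have rq1 : r * q <= q by rewrite ler_piMl.
have rq0 : 0 <= r * q by rewrite mulr_ge0.
by rewrite mulrBr mulr1; apply/andP; split; lra.
Qed.

(** Induction on [L^(k+1) - K^(k+1) = L (L^k - K^k) + (L - K) K^k]. The assumption [1 <= M] lets
    both summands carry the same power of [M]. *)
Lemma iter_diff L K (M e : R) k X : linear_map L -> linear_map K -> 1 <= M ->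
  opn L <= M -> opn K <= M -> 0 <= e -> (forall Y, nrm (L Y - K Y) <= e * nrm Y) ->
  nrm (iter k L X - iter k K X) <= k%:R * M ^+ k * e * nrm X.
Proof.
move=> hL hK M1 LM KM e0 he.
have M0 : 0 <= M by exact: le_trans M1.
elim: k => [|k IH]; first by rewrite subrr nrm0 !mul0r.
rewrite !iterS.
have -> : L (iter k L X) - K (iter k K X) =
    L (iter k L X - iter k K X) + (L (iter k K X) - K (iter k K X)).
  by rewrite (linear_mapB hL) addrA subrK.
apply: le_trans (nrmD _ _) _.
have h1 : nrm (L (iter k L X - iter k K X)) <= M * (k%:R * M ^+ k * e * nrm X).
  apply: le_trans (nrm_le _ hL) _.
  by apply: ler_pM => //; [exact: opn_ge0|exact: nrm_ge0].
have h2 : nrm (iter k K X) <= M ^+ k * nrm X.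
  apply: le_trans (nrm_iter k X hK) _; rewrite ler_wpM2r ?nrm_ge0 //.
  by rewrite lerXn2r ?nnegrE ?opn_ge0.
have h3 := le_trans (he (iter k K X)) (ler_wpM2l e0 h2).
apply: le_trans (lerD h1 h3) _.
have -> : k.+1%:R * M ^+ k.+1 * e * nrm X =
  M * (k%:R * M ^+ k * e * nrm X) + M * (e * (M ^+ k * nrm X)).
  by rewrite exprS -addn1 natrD; ring.
rewrite lerD2l ler_peMl // !mulr_ge0 ?exprn_ge0 ?nrm_ge0 //.
Qed.

(** Term by term, [w L^k - w r K^k = w (1 - r) L^k + w r (L^k - K^k)] with [w = t^k / k!] and [r]
    the ratio of [ffact_ratio]. The first part costs [k^2/m] and the second [k e]. The partial sum
    has [m + 1] terms to match the binomial expansion. *)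
Lemma expmap_approx L K (M e t : R) m X : linear_map L -> linear_map K -> 1 <= M ->
  opn L <= M -> opn K <= M -> 0 <= e -> (forall Y, nrm (L Y - K Y) <= e * nrm Y) ->
  0 <= t -> (0 < m)%N ->
  nrm (pexp L t m.+1 X - iter m (fun Y => Y + (t / m%:R)%:C *: K Y) X) <=
    (m%:R^-1 + e) * expR (t * (4%:R * M)) * nrm X.
Proof.
move=> hL hK M1 LM KM e0 he t0 m0; have m0' : 0 < m%:R :> R by rewrite ltr0n.
have M0 : 0 <= M by exact: le_trans M1.
have tM0 : 0 <= t * (4%:R * M) by rewrite !mulr_ge0.
rewrite iter_binomial // /pexp -sumrB; apply: le_trans (nrm_sum _ _ _) _.
apply: (@le_trans _ _ ((m%:R^-1 + e) * (\sum_(k < m.+1) (t * (4%:R * M)) ^+ k / k`!%:R) * nrm X)); last first.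
  by rewrite ler_wpM2r ?nrm_ge0 // ler_wpM2l ?exp_sum_le // addr_ge0 ?invr_ge0.
rewrite [(m%:R^-1 + e) * _]mulr_sumr mulr_suml; apply: ler_sum => -[k /=]; rewrite ltnS => km _.
rewrite exp_coeffC; set w := t ^+ k / k`!%:R; set r : R := (m ^_ k)%N%:R / m%:R ^+ k.
have w0 : 0 <= w by exact: exp_coeff_ge.
have -> : 'C(m, k)%:R * (t / m%:R) ^+ k = w * r.
  have Em : (m ^_ k)%N%:R = 'C(m, k)%:R * k`!%:R :> R by rewrite -natrM bin_ffact.
  rewrite expr_div_n /r Em /w; have : k`!%:R != 0 :> R by rewrite pnatr_eq0 -lt0n fact_gt0.
  have : m%:R ^+ k != 0 :> R by rewrite expf_neq0 ?gt_eqF.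
  by move=> a b; field; rewrite a b.
have /andP[r1 r2] := ffact_ratio m0 km; rewrite -/r in r1 r2.
have -> : w%:C *: iter k L X - (w * r)%:C *: iter k K X =
  (w * (1 - r))%:C *: iter k L X + (w * r)%:C *: (iter k L X - iter k K X).
  rewrite scalerBr addrA; congr (_ - _); rewrite -scalerDl -rmorphD /=; congr (_%:C *: _); ring.
have r0 : 0 <= r by rewrite divr_ge0 ?exprn_ge0.
have wr0 : 0 <= w * r by apply: mulr_ge0.
have w1r0 : 0 <= w * (1 - r) by apply: mulr_ge0; rewrite ?subr_ge0.
apply: le_trans (nrmD _ _) _; rewrite !nrmZ !normc_real !ger0_norm //.
(* The factor [4^k] dominates both [k^2] and [k], so the polynomial losses are absorbed into the
   exponential series at [4 t M]. *)
have k4 : (k ^ 2)%N%:R <= 4%:R ^+ k :> R.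
  rewrite -natrX ler_nat -[4%N]/(2 ^ 2)%N -expnM mulnC expnM leq_exp2r //.
  exact: ltnW (ltn_expl _ _).
have k4' : k%:R <= 4%:R ^+ k :> R.
  by apply: le_trans k4; rewrite ler_nat; case: (k) => // n; rewrite leq_pmulr.
have hL' : nrm (iter k L X) <= M ^+ k * nrm X.
  apply: le_trans (nrm_iter k X hL) _; rewrite ler_wpM2r ?nrm_ge0 //.
  by rewrite lerXn2r ?nnegrE ?opn_ge0.
have hD := iter_diff k X hL hK M1 LM KM e0 he.
have -> : (m%:R^-1 + e) * ((t * (4%:R * M)) ^+ k / k`!%:R) * nrm X =
  w * (4%:R ^+ k / m%:R) * (M ^+ k * nrm X) + w * (4%:R ^+ k * M ^+ k * e * nrm X).
  by rewrite /w !exprMn; ring.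
have Mk : 0 <= M ^+ k by rewrite exprn_ge0.
have h1 : w * (1 - r) <= w * (4%:R ^+ k / m%:R).
  rewrite ler_wpM2l //; apply: (@le_trans _ _ ((k ^ 2)%N%:R / m%:R)); first lra.
  by rewrite ler_wpM2r ?invr_ge0.
have h2 : w * r <= w by rewrite ler_piMr.
have h3 : k%:R * M ^+ k * e * nrm X <= 4%:R ^+ k * M ^+ k * e * nrm X.
  by rewrite ler_wpM2r ?nrm_ge0 // ler_wpM2r // ler_wpM2r.
apply: lerD; first by apply: ler_pM; rewrite // ?nrm_ge0 // mulr_ge0 ?subr_ge0.
by apply: ler_pM (le_trans hD h3); rewrite // ?nrm_ge0 // mulr_ge0.
Qed.

End Exponential.

(** * Adjoints, unitaries and the conjugation maps [Ad] *)

Section Adjoint.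
Variable R : realType.

Lemma adjmx_mul m n p (A : 'M[R[i]]_(m, n)) (B : 'M[R[i]]_(n, p)) :
  adjmx (A *m B) = adjmx B *m adjmx A.
Proof. by rewrite /adjmx map_mxM trmx_mul. Qed.

Lemma adjmxE m n (A : 'M[R[i]]_(m, n)) a b : adjmx A a b = conjc (A b a).
Proof. by rewrite !mxE. Qed.

Lemma adjmxK m n (A : 'M[R[i]]_(m, n)) : adjmx (adjmx A) = A.
Proof. by apply/matrixP => a b; rewrite !adjmxE conjcK. Qed.

Lemma adjmx1 n : adjmx (1%:M : 'M[R[i]]_n) = 1%:M.
Proof. by rewrite /adjmx map_mx1 trmx1. Qed.

Lemma unitary_mx1 d : unitary_mx (1%:M : 'M[R[i]]_d).
Proof. by split; rewrite adjmx1 mul1mx. Qed.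

Lemma unitary_mxM d (U V : 'M[R[i]]_d) : unitary_mx U -> unitary_mx V -> unitary_mx (U *m V).
Proof.
move=> [u1 u2] [v1 v2]; split; rewrite adjmx_mul.
  by rewrite -mulmxA (mulmxA _ U) u1 mul1mx.
by rewrite -mulmxA (mulmxA V) v2 mul1mx.
Qed.

Lemma Ad1 d (X : 'M[R[i]]_d) : Ad 1%:M X = X.
Proof. by rewrite /Ad adjmx1 mul1mx mulmx1. Qed.

Lemma AdM d (U V X : 'M[R[i]]_d) : Ad U (Ad V X) = Ad (V *m U) X.
Proof. by rewrite /Ad adjmx_mul !mulmxA. Qed.

Lemma Ad_linear d (U : 'M[R[i]]_d) : linear_map (Ad U).
Proof. by move=> a X Y; rewrite /Ad mulmxDr mulmxDl -scalemxAr -scalemxAl. Qed.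

Lemma cone_linear d (K : 'M[R[i]]_d -> 'M[R[i]]_d) : in_unitary_cone K -> linear_map K.
Proof.
move=> [l [c [U [_ [_ hK]]]]] a X Y; rewrite !hK scaler_sumr -big_split /=.
apply: eq_bigr => j _; rewrite Ad_linear opprD addrACA -scalerBr scalerDr.
by rewrite !scalerA mulrC.
Qed.

End Adjoint.

(** * Mixed unitary maps and a bound on the number of unitaries *)

Section MixedUnitary.
Variables (R : realType) (d : nat).
Implicit Types (Phi Psi K : 'M[R[i]]_d -> 'M[R[i]]_d).

Lemma mixed_unitary_fin (I : finType) (lam : I -> R) (U : I -> 'M[R[i]]_d) Phi :
  (forall j, 0 <= lam j) -> \sum_j lam j = 1 -> (forall j, unitary_mx (U j)) ->
  (forall X, Phi X = \sum_j (lam j)%:C *: Ad (U j) X) -> mixed_unitary Phi.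
Proof.
move=> h1 h2 h3 h4; exists #|I|, (lam \o enum_val), (U \o enum_val); split; first by move=> j /=.
have hb : {on predT, bijective (@enum_val I I)} by apply: onW_bij; exact: enum_val_bij.
split; first by rewrite -h2 (reindex _ hb).
by split=> [j|X]; [exact: h3|rewrite h4 (reindex _ hb)].
Qed.

Lemma mixed_unitary_comp Phi Psi : mixed_unitary Phi -> mixed_unitary Psi ->
  mixed_unitary (fun X => Phi (Psi X)).
Proof.
move=> [l [lam [U [h1 [h2 [h3 h4]]]]]] [l' [lam' [U' [h1' [h2' [h3' h4']]]]]].
(* The unitaries multiply in reverse order because [Ad U] puts the adjoint on the left. *)
apply: (@mixed_unitary_fin _ (fun p : 'I_l * 'I_l' => lam p.1 * lam' p.2)
  (fun p => U' p.2 *m U p.1)).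
- by move=> p; rewrite mulr_ge0.
- rewrite -(pair_bigA _ (fun i j => lam i * lam' j)) /= -[RHS]h2.
  by apply: eq_bigr => i _; rewrite -mulr_sumr h2' mulr1.
- by move=> p; apply: unitary_mxM.
move=> X /=; rewrite h4 -(pair_bigA _ (fun i j => (lam i * lam' j)%:C *: Ad (U' j *m U i) X)) /=.
apply: eq_bigr => i _; rewrite h4' (linear_map_sum _ _ _ (Ad_linear (U i))) scaler_sumr.
apply: eq_bigr => j _; rewrite (linear_mapZ (Ad_linear (U i))) scalerA rmorphM /=.
by rewrite AdM.
Qed.

Lemma mixed_unitary_iter Phi n : mixed_unitary Phi -> mixed_unitary (iter n Phi).
Proof.
move=> h; elim: n => [|n IH]; last exact: mixed_unitary_comp.
apply: (@mixed_unitary_fin _ (fun _ : 'I_1 => 1) (fun _ => 1%:M)) => //.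
- by rewrite big_ord1.
- by move=> _; exact: unitary_mx1.
by move=> X; rewrite big_ord1 scale1r Ad1.
Qed.

(** With [B] the total weight of [K], the map is [(1 - c B) id + c \sum_j lam_j Ad U_j], a convex
    combination once [c B <= 1]. The extra index 0 carries the identity. *)
Lemma mixed_unitary_step K : in_unitary_cone K -> exists B : R, forall c : R, 0 <= c -> c * B <= 1 ->
  mixed_unitary (fun X => X + c%:C *: K X).
Proof.
move=> [l [lam [U [h1 [h2 h3]]]]]; exists (\sum_j lam j) => c c0 hc.
exists l.+1, (fun j => if unlift ord0 j is Some k then c * lam k else 1 - c * \sum_j lam j).
exists (fun j => if unlift ord0 j is Some k then U k else 1%:M).
split; first by move=> j; case: unliftP => [k _|_]; rewrite ?mulr_ge0 ?subr_ge0.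
split.
  rewrite big_ord_recl unlift_none; under [X in _ + X]eq_bigr do rewrite liftK.
  by rewrite -mulr_sumr subrK.
split; first by move=> j; case: unliftP => // _; exact: unitary_mx1.
move=> X; rewrite big_ord_recl unlift_none; under [X in _ = _ + X]eq_bigr do rewrite liftK.
rewrite Ad1 h3 scaler_sumr rmorphB rmorph1 scalerBl scale1r -addrA; congr (_ + _).
rewrite mulr_sumr rmorph_sum scaler_suml -sumrN -big_split /=.
by apply: eq_bigr => j _; rewrite scalerA scalerBr rmorphM addrC.
Qed.

Definition mixed_len l Phi := exists (lam : 'I_l -> R) (U : 'I_l -> 'M[R[i]]_d),
    (forall j, 0 <= lam j) /\ \sum_(j < l) lam j = 1 /\
    (forall j, unitary_mx (U j)) /\
    forall X, Phi X = \sum_(j < l) (lam j)%:C *: Ad (U j) X.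

Lemma mixed_len_up l Phi : mixed_len l Phi -> mixed_len l.+1 Phi.
Proof.
move=> [lam [U [h1 [h2 [h3 h4]]]]].
exists (fun j => if unlift ord0 j is Some k then lam k else 0).
exists (fun j => if unlift ord0 j is Some k then U k else 1%:M).
split; first by move=> j; case: unliftP.
split; first by rewrite big_ord_recl unlift_none add0r -h2; apply: eq_bigr => j _; rewrite liftK.
split; first by move=> j; case: unliftP => // _; exact: unitary_mx1.
move=> X; rewrite h4 big_ord_recl unlift_none scale0r add0r.
by apply: eq_bigr => j _; rewrite liftK.
Qed.

(* Conic Caratheodory: a linear relation among the [w j] is subtracted until some weight vanishes. *)
Lemma caratheodory_step D l (w : 'I_l.+1 -> 'rV[R]_D) (lam : 'I_l.+1 -> R) :
  (D <= l)%N -> (forall j, 0 <= lam j) ->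
  exists (i0 : 'I_l.+1) (mu : 'I_l.+1 -> R), (forall j, 0 <= mu j) /\ mu i0 = 0 /\
    \sum_j mu j *: w j = \sum_j lam j *: w j.
Proof.
move=> Dl lam0; pose W := \matrix_(j, k) w j 0 k.
(* There are [l + 1] vectors in dimension [D <= l], so they are linearly dependent. *)
have [u [u0 uW]] : exists u : 'rV[R]_l.+1, u != 0 /\ u *m W = 0.
  have : kermx W != 0.
    rewrite kermx_eq0 -row_leq_rank -ltnNge; apply: leq_ltn_trans (rank_leq_col W) _.
    by rewrite ltnS.
  by move=> /rowV0Pn[v /sub_kermxP vW v0]; exists v.
have {uW}uw : \sum_j u 0 j *: w j = 0.
  apply/rowP => k; rewrite summxE -uW mxE.
  by apply: eq_bigr => j _; rewrite !mxE.
(* Changing the sign of the relation provides a positive coefficient. *)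
wlog [j0 hj0] : u u0 uw / exists j0, 0 < u 0 j0.
  move=> H; have [j hj] : exists j, u 0 j != 0.
    by move/rV0Pn: u0.
  have [pj|nj] := ltP 0 (u 0 j); first by apply: (H u) => //; exists j.
  apply: (H (- u)); rewrite ?oppr_eq0 //; last first.
    by exists j; rewrite mxE oppr_gt0 lt_neqAle hj.
  transitivity (- \sum_j u 0 j *: w j); last by rewrite uw oppr0.
  by rewrite -sumrN; apply: eq_bigr => i _; rewrite mxE scaleNr.
(* The least ratio is the largest multiple of [u] that can be subtracted with all weights staying
   nonnegative, and it makes the weight at the minimizer vanish. *)
pose i0 := [arg min_(i < j0 | 0 < u 0 i) (lam i / u 0 i)]%O.
have : 0 < u 0 i0 /\ forall j, 0 < u 0 j -> lam i0 / u 0 i0 <= lam j / u 0 j.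
  by rewrite /i0; case: Order.TotalTheory.arg_minP.
move: i0 => i1 [ui0 hmin]; exists i1.
exists (fun j => lam j - lam i1 / u 0 i1 * u 0 j); split; last split.
- move=> j; rewrite subr_ge0; have [pj|nj] := ltP 0 (u 0 j).
    by rewrite -ler_pdivlMr // hmin.
  apply: le_trans (lam0 j); rewrite mulr_ge0_le0 // divr_ge0 // ltW //.
- by rewrite divfK ?subrr // gt_eqF.
transitivity (\sum_j lam j *: w j - (lam i1 / u 0 i1) *: \sum_j u 0 j *: w j).
  rewrite scaler_sumr -sumrB; apply: eq_bigr => j _.
  by rewrite scalerBl scalerA.
by rewrite uw scaler0 subr0.
Qed.

(** Two real coordinates, real and imaginary part, for each coefficient of a map, and one more
    ([None]) for the sum of the weights. *)
Definition coord_num := #|{: option (quad d * bool)}|.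

Lemma mixed_linear Phi l (lam : 'I_l -> R) (U : 'I_l -> 'M[R[i]]_d) :
  (forall X, Phi X = \sum_(j < l) (lam j)%:C *: Ad (U j) X) -> linear_map Phi.
Proof.
move=> h a X Y; rewrite !h scaler_sumr -big_split /=.
apply: eq_bigr => j _; rewrite Ad_linear scalerDr !scalerA mulrC //.
Qed.

Lemma linear_map_ext Phi Psi : linear_map Phi -> linear_map Psi ->
  (forall q, ent Phi q = ent Psi q) -> forall X, Phi X = Psi X.
Proof.
move=> h h' H X; apply/matrixP => a b; rewrite !linear_mapE //.
by apply: eq_bigr => p _; rewrite H.
Qed.

(** The Caratheodory step is applied to the real coordinate vectors of the maps [Ad (U j)], and the
    index whose weight vanishes is dropped. *)
Lemma mixed_len_down l Phi : (coord_num <= l)%N -> mixed_len l.+1 Phi -> mixed_len l Phi.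
Proof.
move=> hl [lam [U [h1 [h2 [h3 h4]]]]].
(* The coordinate [None] is constantly 1, so that preserving it preserves the total weight. *)
pose co (j : 'I_l.+1) (o : option (quad d * bool)) : R :=
  match o with None => 1
  | Some (q, true) => Re (ent (Ad (U j)) q)
  | Some (q, false) => Im (ent (Ad (U j)) q) end.
pose w j : 'rV[R]_coord_num := \row_k co j (enum_val k).
have [i0 [mu [m1 [m2 m3]]]] := caratheodory_step w hl h1.
have {m3}m3 o : \sum_j mu j * co j o = \sum_j lam j * co j o.
  move/rowP/(_ (enum_rank o)): m3; rewrite !summxE.
  under eq_bigr do rewrite !mxE enum_rankK.
  by under [in RHS]eq_bigr do rewrite !mxE enum_rankK.
exists (mu \o lift i0), (U \o lift i0); split; first by move=> j /=.
split.
  rewrite -h2; have := m3 None; rewrite /= -!mulr_suml !mulr1 => <-.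
  by rewrite (bigD1_ord i0) //= m2 add0r.
split; first by move=> j /=.
have hmu X : \sum_(j < l) (mu (lift i0 j))%:C *: Ad (U (lift i0 j)) X =
  \sum_j (mu j)%:C *: Ad (U j) X.
  by rewrite [RHS](bigD1_ord i0) //= m2 scale0r add0r.
move=> X; rewrite /= hmu.
apply: (linear_map_ext (Psi := fun X => \sum_j (mu j)%:C *: Ad (U j) X)) => {X}.
- exact: mixed_linear h4.
- exact: mixed_linear.
move=> q; rewrite /ent h4 !summxE; apply/eqP; rewrite eq_complex.
have Re_co (nu : 'I_l.+1 -> R) : Re (\sum_j ((nu j)%:C *: Ad (U j) (delta_mx q.1.1 q.1.2)) q.2.1 q.2.2) =
    \sum_j nu j * co j (Some (q, true)).
  rewrite raddf_sum; apply: eq_bigr => j _; rewrite mxE /= /ent.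
  by case: (Ad _ _ _ _) => x y /=; rewrite mul0r subr0.
have Im_co (nu : 'I_l.+1 -> R) : Im (\sum_j ((nu j)%:C *: Ad (U j) (delta_mx q.1.1 q.1.2)) q.2.1 q.2.2) =
    \sum_j nu j * co j (Some (q, false)).
  rewrite raddf_sum; apply: eq_bigr => j _; rewrite mxE /= /ent.
  by case: (Ad _ _ _ _) => x y /=; rewrite mul0r addr0.
by rewrite !Re_co !Im_co !m3 !eqxx.
Qed.

Lemma mixed_len_coord_num Phi : mixed_unitary Phi -> mixed_len coord_num Phi.
Proof.
move=> [l]; rewrite -/(mixed_len l Phi); have [/subnK<-|/ltnW /subnK<-] := leqP coord_num l.
  elim: (l - coord_num)%N => // n IH; rewrite addSn => h; apply: IH.
  by apply: mixed_len_down h; rewrite leq_addl.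
move=> h; elim: (coord_num - l)%N => // n IH; rewrite addSn; exact: mixed_len_up.
Qed.

End MixedUnitary.

(** * Closedness of the set of mixed unitary maps *)

Section Closure.
Variables (R : realType).

Definition mclim (F : set_system nat) m n (u : nat -> 'M[R[i]]_(m, n)) (l : 'M[R[i]]_(m, n)) :=
  forall a b, clim F (fun k => u k a b) (l a b).

Lemma mclimM F m n p (u : nat -> 'M[R[i]]_(m, n)) (v : nat -> 'M[R[i]]_(n, p)) (a : 'M_(m, n)) (b : 'M_(n, p)) :
  Filter F -> mclim F u a -> mclim F v b -> mclim F (fun k => u k *m v k) (a *m b).
Proof.
move=> FF hu hv i j; rewrite mxE; under eq_fun do rewrite mxE.
by apply: clim_sum => k _; apply: climM.
Qed.

Lemma mclimJ F m n (u : nat -> 'M[R[i]]_(m, n)) (a : 'M_(m, n)) :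
  Filter F -> mclim F u a -> mclim F (fun k => adjmx (u k)) (adjmx a).
Proof.
move=> FF hu i j; rewrite adjmxE; under eq_fun do rewrite adjmxE.
exact: climJ.
Qed.

Lemma mclim_cst F m n (a : 'M[R[i]]_(m, n)) : Filter F -> mclim F (fun=> a) a.
Proof. by move=> FF i j; exact: clim_cst. Qed.

Lemma mclim_uniq F m n (u : nat -> 'M[R[i]]_(m, n)) (a b : 'M_(m, n)) : ProperFilter F ->
  mclim F u a -> mclim F u b -> a = b.
Proof. by move=> FF ha hb; apply/matrixP => i j; exact: clim_uniq (ha i j) (hb i j). Qed.

Lemma conjc_mul_normc (z : R[i]) : conjc z * z = (normc z ^+ 2)%:C.
Proof.
case: z => x y /=; rewrite sqr_sqrtr ?addr_ge0 ?sqr_ge0 //.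
by apply/eqP; rewrite eq_complex /=; apply/andP; split; apply/eqP; ring.
Qed.

(** Column [b] of a unitary matrix has Euclidean norm 1. *)
Lemma unitary_bounded d (U : 'M[R[i]]_d) a b : unitary_mx U -> normc (U a b) <= 1.
Proof.
move=> [/matrixP/(_ b b) + _]; rewrite !mxE eqxx => /(congr1 (@complex.Re R)).
rewrite raddf_sum (bigD1 a) //= adjmxE conjc_mul_normc /= => h.
rewrite -(@ler_pXn2r _ 2) ?nnegrE ?normc_ge0 // expr1n -h lerDl.
by apply: sumr_ge0 => k _; rewrite adjmxE conjc_mul_normc /= sqr_ge0.
Qed.

(** Normalization of the weights, unitarity and the formula for the map are polynomial identities in
    the weights, the entries and their conjugates. Each passes to the limit along one ultrafilter by
    uniqueness of limits. *)
Lemma mixed_unitary_closed d (G : nat -> 'M[R[i]]_d -> 'M[R[i]]_d) E :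
  (forall n, mixed_unitary (G n)) -> (forall X, mx_cvg (fun n => G n X) (E X)) ->
  mixed_unitary E.
Proof.
move=> hG hE; have [F [UF hF]] := ultraFilterLemma (eventually_filter : ProperFilter \oo).
have PF : ProperFilter F by exact: ultra_proper.
have FF : Filter F by exact: PF.
set D := coord_num d.
have /choice[lU hlU] : forall n, exists lU : ('I_D -> R) * ('I_D -> 'M[R[i]]_d),
    (forall j, 0 <= lU.1 j) /\ \sum_(j < D) lU.1 j = 1 /\
    (forall j, unitary_mx (lU.2 j)) /\
    forall X, G n X = \sum_(j < D) (lU.1 j)%:C *: Ad (lU.2 j) X.
  by move=> n; have [lam [U h]] := mixed_len_coord_num (hG n); exists (lam, U).
have /choice[lam hlam] : forall j, exists l, clim F (fun n => ((lU n).1 j)%:C) l.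
  move=> j; apply: (@clim_bounded _ _ _ 1) => n; have [h1 [h2 _]] := hlU n.
  rewrite normc_real ger0_norm // -h2 (bigD1 j) //= lerDl.
  by apply: sumr_ge0 => k _.
have /choice[V hV] : forall p : 'I_D * ('I_d * 'I_d), exists l,
    clim F (fun n => (lU n).2 p.1 p.2.1 p.2.2) l.
  move=> p; apply: (@clim_bounded _ _ _ 1) => n; have [_ [_ [h3 _]]] := hlU n.
  exact: unitary_bounded.
pose U j : 'M[R[i]]_d := \matrix_(a, b) V (j, (a, b)).
have hU j : mclim F (fun n => (lU n).2 j) (U j).
  by move=> a b; rewrite mxE; exact: (hV (j, (a, b))).
have lamR j : lam j = (Re (lam j))%:C.
  have [_ h] := hlam j; apply/eqP; rewrite eq_complex /= eqxx /=.
  by apply/eqP; apply: (cvg_unique (@Rhausdorff R) h); exact: cvg_cst.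
exists D, (fun j => Re (lam j)), U; split; last split; last split.
- move=> j; have [h _] := hlam j; apply: (cvgr_to_ge h).
  by apply: nearW => n; have [h1 _] := hlU n; exact: h1.
- apply: complexI; rewrite rmorph_sum /=; under eq_bigr do rewrite -lamR.
  apply: (@clim_uniq _ F (fun=> 1)); last exact: clim_cst.
  rewrite (_ : (fun=> 1) = (fun n => \sum_j ((lU n).1 j)%:C)); first exact: clim_sum.
  by apply/funext => n; have [_ [h2 _]] := hlU n; rewrite -rmorph_sum h2.
- move=> j; split; apply: (@mclim_uniq F _ _ (fun=> 1%:M)) => //; try exact: mclim_cst.
    rewrite (_ : (fun=> 1%:M) = (fun n => adjmx ((lU n).2 j) *m (lU n).2 j)).
      by apply: mclimM => //; apply: mclimJ.
    by apply/funext => n; have [_ [_ [h3 _]]] := hlU n; have [-> _] := h3 j.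
  rewrite (_ : (fun=> 1%:M) = (fun n => (lU n).2 j *m adjmx ((lU n).2 j))).
    by apply: mclimM => //; apply: mclimJ.
  by apply/funext => n; have [_ [_ [h3 _]]] := hlU n; have [_ ->] := h3 j.
move=> X; apply: (@mclim_uniq F _ _ (fun n => G n X)) => //.
  (* The ultrafilter refines [\oo], so the given convergence to [E X] also holds along it. *)
  by move=> a b; apply: clim_sub hF _; have /mx_cvg_clim := hE X; exact.
move=> a b; rewrite summxE (_ : (fun k => _) =
    (fun n => \sum_j ((lU n).1 j)%:C * Ad ((lU n).2 j) X a b)); last first.
  apply/funext => n; have [_ [_ [_ ->]]] := hlU n; rewrite summxE.
  by apply: eq_bigr => j _; rewrite mxE.
apply: clim_sum => j _; rewrite mxE -lamR; apply: climM => //.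
apply: mclimM => //; apply: mclimM => //; [exact: mclimJ|exact: mclim_cst].
Qed.

End Closure.

(** * Generators of mixed unitary semigroups and the closed cone *)

Section Generators.
Variables (R : realType) (d : nat).
Implicit Types (L K : 'M[R[i]]_d -> 'M[R[i]]_d).

Lemma linear_map_diff L K : linear_map L -> linear_map K -> linear_map (fun X => L X - K X).
Proof. by move=> hL hK a X Y; rewrite hL hK opprD addrACA scalerBr. Qed.

Lemma archi_invS (e : R) : 0 < e -> exists N : nat, forall n, (N <= n)%N -> n.+1%:R^-1 < e.
Proof.
move=> e0; exists (Num.truncn e^-1).+1 => n hn.
rewrite invf_plt ?posrE ?ltr0n //; apply: lt_trans (truncnS_gt _) _.
by rewrite ltr_nat ltnS.
Qed.

(** Pointwise convergence on the finitely many matrix units already controls [opn]. *)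
Lemma closed_cone_approx L : in_closed_unitary_cone L -> forall e : R, 0 < e ->
  exists K, in_unitary_cone K /\ opn (fun X => L X - K X) <= e.
Proof.
move=> [Ks [hK hl]] e e0.
(* The successor keeps the denominator nonzero even when there are no coefficients. *)
have c0 : 0 < e / #|{: quad d}|.+1%:R by rewrite divr_gt0.
have /choice[N hN] : forall q : quad d, exists N : nat, forall k, (N <= k)%N ->
    normc (ent (Ks k) q - ent L q) < e / #|{: quad d}|.+1%:R.
  move=> q; have /mx_cvgP/(_ _ c0)[N h] := hl (delta_mx q.1.1 q.1.2).
  by exists N => k /h; exact.
exists (Ks (\max_q N q)); split; first exact: hK.
apply: (@le_trans _ _ (\sum_(q : quad d) e / #|{: quad d}|.+1%:R)).
  apply: ler_sum => q _; rewrite /ent mxE [X in _ + X]mxE normcB; apply/ltW/hN.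
  exact: leq_bigmax.
rewrite sumr_const -(mulr_natr (e / _)) -mulrA ler_piMr ?(ltW e0) //.
by rewrite mulrC ler_pdivrMr ?mul1r ?ler_nat ?leqnSn.
Qed.

Lemma approx_closed_cone L : linear_map L ->
  (forall e : R, 0 < e -> exists K, in_unitary_cone K /\ opn (fun X => L X - K X) <= e) ->
  in_closed_unitary_cone L.
Proof.
move=> hL h.
have /choice[Ks hKs] : forall n : nat, exists K, in_unitary_cone K /\
    opn (fun X => L X - K X) <= n.+1%:R^-1 by move=> n; apply: h; rewrite invr_gt0.
exists Ks; split=> [n|X]; first by have [] := hKs n.
apply/mx_cvgP => e e0.
have X1 : 0 < nrm X + 1 by rewrite ltr_wpDl ?nrm_ge0.
have [N hN] := archi_invS (divr_gt0 e0 X1).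
exists N => k /hN hk a b; have [hc ho] := hKs k.
have hl := linear_map_diff hL (cone_linear hc).
have -> : Ks k X a b - L X a b = - (L X - Ks k X) a b by rewrite !mxE opprB.
rewrite normcN; apply: le_lt_trans (normc_le_nrm _ a b) _.
apply: le_lt_trans (nrm_le X hl) _.
move: hk; rewrite ltr_pdivlMr //; apply: le_lt_trans.
apply: ler_pM => //; [exact: opn_ge0|exact: nrm_ge0|by rewrite lerDl].
Qed.

Lemma semigroup_closed_cone L : linear_map L ->
  (forall t : R, 0 <= t -> exists E, is_expmap L t E /\ mixed_unitary E) ->
  in_closed_unitary_cone L.
Proof.
move=> hL h.
have /choice[E hE] : forall n : nat, exists E,
    is_expmap L n.+1%:R^-1 E /\ mixed_unitary E by move=> n; apply: h; rewrite invr_ge0.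
exists (fun n X => (n.+1%:R : R)%:C *: (E n X - X)); split=> [n|X].
  have [_ [l [lam [U [h1 [h2 [h3 h4]]]]]]] := hE n.
  exists l, (fun j => n.+1%:R * lam j), U; split; first by move=> j; rewrite mulr_ge0.
  (* Since the weights sum to 1, the subtracted [X] is spread over the sum, which gives differences
     [Ad (U j) X - X]. *)
  split=> // X; rewrite h4 -[X in _ - X]scale1r -[1 in X in _ - X](rmorph1 (real_complex R)) -h2.
  rewrite rmorph_sum scaler_suml -sumrB scaler_sumr; apply: eq_bigr => j _.
  by rewrite -scalerBr scalerA rmorphM.
apply/mx_cvgP => e e0.
set C := expR (opn L) * nrm X.
have C0 : 0 <= C by rewrite mulr_ge0 ?nrm_ge0 // (le_trans _ (exp_sum_le 0 (opn_ge0 L))) // big_ord0.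
(* [C] vanishes when [X = 0], so [C + 1] is the divisor. *)
have C1 : 0 < C + 1 by rewrite ltr_wpDl.
have [N hN] := archi_invS (divr_gt0 e0 C1).
exists N => n /hN hn a b; have [hexp _] := hE n.
have n0 : 0 < n.+1%:R :> R by rewrite ltr0n.
have t01 : 0 <= (n.+1%:R^-1 : R) <= 1 by rewrite invr_ge0 ler0n invf_le1 // ler1n.
have := expmap_first_order X a b hL t01 hexp; rewrite -/C => hb.
have -> : ((n.+1%:R : R)%:C *: (E n X - X)) a b - L X a b =
  (n.+1%:R : R)%:C * (E n X - (X + (n.+1%:R^-1 : R)%:C *: L X)) a b.
  rewrite !mxE !mulrDr opprD mulrDr !mulrN mulrA -rmorphM /= mulfV ?gt_eqF // mul1r addrA //.
rewrite normcM normc_real gtr0_norm //.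
apply: le_lt_trans (ler_wpM2l (ltW n0) hb) _.
rewrite expr2 !mulrA mulfV ?gt_eqF // mul1r.
move: hn; rewrite ltr_pdivlMr //; apply: le_lt_trans.
by rewrite -mulrA ler_wpM2l ?invr_ge0 // lerDl.
Qed.

Lemma closed_cone_semigroup L : linear_map L -> in_closed_unitary_cone L ->
  forall t : R, 0 <= t -> exists E, is_expmap L t E /\ mixed_unitary E.
Proof.
move=> hL hc t t0; have [E hE] := expmap_exists hL t0; exists E; split=> //.
(* A cone element within [1/(n+1)] of [L] is paired with an exponent so large that one step of size
   [t/m] is mixed unitary. *)
have /choice[Km hKm] : forall n : nat, exists Km : ('M[R[i]]_d -> 'M[R[i]]_d) * nat,
    [/\ in_unitary_cone Km.1, opn (fun X => L X - Km.1 X) <= n.+1%:R^-1, (n < Km.2)%N &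
     mixed_unitary (fun X => X + (t / Km.2%:R)%:C *: Km.1 X)].
  move=> n; have n0 : 0 < n.+1%:R^-1 :> R by rewrite invr_gt0.
  have [K [K1 K2]] := closed_cone_approx hc n0.
  have [B hB] := mixed_unitary_step K1.
  (* The exponent exceeds both [n] and [t * B]; the latter is the condition of [mixed_unitary_step]
     for [c = t/m]. *)
  exists (K, (maxn n (Num.truncn (t * B))).+1); split=> //=.
    by rewrite ltnS leq_maxl.
  apply: hB; first by rewrite divr_ge0.
  rewrite mulrAC ler_pdivrMr ?ltr0n // mul1r.
  apply: le_trans (ltW (truncnS_gt _)) _; by rewrite ler_nat ltnS leq_maxr.
apply: (@mixed_unitary_closed _ _
  (fun n => iter (Km n).2 (fun X => X + (t / (Km n).2%:R)%:C *: (Km n).1 X))).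
  by move=> n; apply: mixed_unitary_iter; have [] := hKm n.
move=> X; apply/mx_cvgP => e e0.
have e2 : 0 < e / 2 by rewrite divr_gt0.
(* One extra unit also bounds [opn K], as [K] is within distance 1 of [L]. The factor 2 in [C] comes
   from [1/m + 1/(n+1) <= 2/(n+1)]. *)
pose M := opn L + 1.
set C := 2 * expR (t * (4%:R * M)) * nrm X.
have M1 : 1 <= M by rewrite lerDr opn_ge0.
have tM0 : 0 <= t * (4%:R * M) by rewrite !mulr_ge0 // (le_trans _ M1).
have eR0 : 0 <= expR (t * (4%:R * M)) by rewrite (le_trans _ (exp_sum_le 0 tM0)) // big_ord0.
have C0 : 0 <= C by rewrite !mulr_ge0 ?nrm_ge0.
have C1 : 0 < C + 1 by rewrite ltr_wpDl.
have [N1 hN1] := archi_invS (divr_gt0 e2 C1).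
have /mx_cvgP/(_ _ e2)[N2 hN2] := hE X.
exists (maxn N1 N2) => n; rewrite geq_max => /andP[/hN1 n1 n2] a b.
have [K1 K2 K3 _] := hKm n; move: K1 K2 K3; case: (Km n) => K m /= K1 K2 K3.
have hK := cone_linear K1.
have n0 : 0 < n.+1%:R^-1 :> R by rewrite invr_gt0.
have n11 : n.+1%:R^-1 <= 1 :> R by rewrite invf_le1 ?ler1n ?ltr0n.
have hdiff Y : nrm (L Y - K Y) <= n.+1%:R^-1 * nrm Y.
  apply: le_trans (nrm_le Y (linear_map_diff hL hK)) _.
  by rewrite ler_wpM2r ?nrm_ge0.
have KM : opn K <= M.
  apply: (@le_trans _ _ (opn L + opn (fun X => L X - K X))); last by rewrite lerD2l (le_trans K2).
  rewrite -big_split; apply: ler_sum => q _ /=.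
  have -> : ent K q = ent L q + - ent (fun X => L X - K X) q.
    by rewrite /ent !mxE opprB addrC subrK.
  by apply: le_trans (le_normcD _ _) _; rewrite normcN.
have LM : opn L <= M by rewrite lerDl.
have m0 : (0 < m)%N by exact: leq_trans K3.
have := expmap_approx X hL hK M1 LM KM (ltW n0) hdiff t0 m0.
set G := iter m _ X; move=> hG.
have -> : G a b - E X a b = (pexp L t m.+1 X a b - E X a b) + - (pexp L t m.+1 X - G) a b.
  by rewrite !mxE; ring.
apply: le_lt_trans (le_normcD _ _) _; rewrite normcN [e]splitr.
apply: ltrD; first by apply: hN2; rewrite (leq_trans n2) // (leq_trans (ltnW K3)).
apply: le_lt_trans (normc_le_nrm _ a b) _; apply: le_lt_trans hG _.
move: n1; rewrite ltr_pdivlMr //; apply: le_lt_trans.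
apply: (@le_trans _ _ (n.+1%:R^-1 * C)); last by rewrite ler_wpM2l ?lerDl // ltW.
have -> : n.+1%:R^-1 * C = n.+1%:R^-1 * 2 * expR (t * (4%:R * M)) * nrm X by rewrite /C; ring.
rewrite ler_wpM2r ?nrm_ge0 // ler_wpM2r //.
have : m%:R^-1 <= n.+1%:R^-1 :> R by rewrite lef_pV2 ?posrE ?ltr0n // ler_nat.
by move: (m%:R^-1 : R) (n.+1%:R^-1 : R) => x y hm; lra.
Qed.

End Generators.

(** * The inner product of Choi matrices in coordinates *)

Section InnerProduct.
Variables (R : realType) (d : nat).
Implicit Types (X Y : 'M[R[i]]_d) (Phi Psi Th : 'M[R[i]]_d -> 'M[R[i]]_d).

(** This is [hs_ip] without its factor [d^(-2)]. Its real part [dot] is a Euclidean inner product,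
    so the convex geometry takes place over the reals. *)
Definition cdot Phi Psi : R[i] := \sum_(q : quad d) conjc (ent Phi q) * ent Psi q.
Definition dot Phi Psi : R := Re (cdot Phi Psi).

Lemma dotE Phi Psi : dot Phi Psi = \sum_(q : quad d)
  (Re (ent Phi q) * Re (ent Psi q) + Im (ent Phi q) * Im (ent Psi q)).
Proof.
rewrite /dot raddf_sum; apply: eq_bigr => q _ /=.
by case: (ent Phi q) => a b; case: (ent Psi q) => x y /=; rewrite mulNr opprK.
Qed.

Lemma dotC Phi Psi : dot Phi Psi = dot Psi Phi.
Proof.
by rewrite !dotE; apply: eq_bigr => q _; rewrite mulrC [X in _ + X]mulrC.
Qed.

Lemma dotDZr Th Phi Psi (a : R) :
  dot Th (fun X => Phi X + a%:C *: Psi X) = dot Th Phi + a * dot Th Psi.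
Proof.
rewrite !dotE mulr_sumr -big_split; apply: eq_bigr => q _ /=; rewrite /ent !mxE.
by case: (Phi _ _ _) => x y; case: (Psi _ _ _) => x' y' /=; ring.
Qed.

Lemma dotDZl Th Phi Psi (a : R) :
  dot (fun X => Phi X + a%:C *: Psi X) Th = dot Phi Th + a * dot Psi Th.
Proof. by rewrite dotC dotDZr !(dotC Th). Qed.

Lemma dotBr Th Phi Psi : dot Th (fun X => Phi X - Psi X) = dot Th Phi - dot Th Psi.
Proof.
rewrite -mulN1r -dotDZr; congr dot; apply/funext => X.
by rewrite rmorphN1 scaleN1r.
Qed.

Lemma dotBl Th Phi Psi : dot (fun X => Phi X - Psi X) Th = dot Phi Th - dot Psi Th.
Proof. by rewrite dotC dotBr !(dotC Th). Qed.

Lemma dot_sumr Th (I : finType) (c : I -> R) (F : I -> 'M[R[i]]_d -> 'M[R[i]]_d) :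
  dot Th (fun X => \sum_j (c j)%:C *: F j X) = \sum_j c j * dot Th (F j).
Proof.
rewrite dotE; under [RHS]eq_bigr do rewrite dotE mulr_sumr.
rewrite exchange_big; apply: eq_bigr => q _ /=; rewrite /ent summxE !raddf_sum !mulr_sumr -big_split.
apply: eq_bigr => j _; rewrite mxE.
by case: (Th _ _ _) => x y; case: (F _ _ _ _) => x' y' /=; ring.
Qed.

Lemma dot_ge0 Phi : 0 <= dot Phi Phi.
Proof. by rewrite dotE; apply: sumr_ge0 => q _; rewrite addr_ge0 // -expr2 sqr_ge0. Qed.

Lemma normc_sqr_le_dot Phi q : normc (ent Phi q) ^+ 2 <= dot Phi Phi.
Proof.
rewrite dotE (bigD1 q) //=; case: (ent Phi q) => a b /=.
rewrite sqr_sqrtr ?addr_ge0 ?sqr_ge0 // -!expr2 lerDl.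
by apply: sumr_ge0 => p _; rewrite addr_ge0 // -expr2 sqr_ge0.
Qed.

Lemma cdot_trace Phi Psi : cdot Phi Psi =
  \sum_(p : 'I_d * 'I_d) \tr (adjmx (Phi (delta_mx p.1 p.2)) *m Psi (delta_mx p.1 p.2)).
Proof.
rewrite /cdot -(pair_bigA _ (fun p r => conjc (ent Phi (p, r)) * ent Psi (p, r))) /=.
apply: eq_bigr => p _; rewrite /mxtrace.
rewrite -(pair_bigA _ (fun a b => conjc (ent Phi (p, (a, b))) * ent Psi (p, (a, b)))) /= exchange_big.
apply: eq_bigr => b _; rewrite mxE; apply: eq_bigr => a _.
by rewrite adjmxE.
Qed.

Lemma herm_preserving_adjmx Phi X : in_H Phi -> Phi (adjmx X) = adjmx (Phi X).
Proof.
move=> [hl hh].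
have aD (A B : 'M[R[i]]_d) : adjmx (A + B) = adjmx A + adjmx B.
  by apply/matrixP => a b; rewrite !mxE rmorphD.
have aB (A B : 'M[R[i]]_d) : adjmx (A - B) = adjmx A - adjmx B.
  by apply/matrixP => a b; rewrite !mxE rmorphB.
have ai (A : 'M[R[i]]_d) : adjmx ('i *: A) = - 'i *: adjmx A.
  by apply/matrixP => a b; rewrite !mxE rmorphM /=; congr (_ * _); rewrite -[RHS]/(_ +i* _) oppr0.
have h1 : adjmx (Phi (X + adjmx X)) = Phi (X + adjmx X).
  by apply: hh; rewrite aD adjmxK addrC.
have h2 : adjmx (Phi ('i *: (X - adjmx X))) = Phi ('i *: (X - adjmx X)).
  by apply: hh; rewrite ai aB adjmxK scaleNr -scalerN opprB.
move: h1 h2; rewrite (linear_mapZ hl) (linear_mapB hl) (linear_mapD hl) ai aD aB.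
move: (Phi X) (Phi (adjmx X)) => A B h1 h2.
have {}h2 : adjmx B - adjmx A = A - B.
  have i0 : 'i != 0 :> R[i] by rewrite eq_complex /= oner_eq0 andbF.
  by apply: (scalerI i0); rewrite -h2 scaleNr -scalerN opprB.
apply/matrixP => a b; move/matrixP/(_ a b): h1; move/matrixP/(_ a b): h2.
rewrite !mxE; move: (conjc (A b a)) (conjc (B b a)) (A a b) (B a b) => x y z w e1 e2.
have : 2%:R * w = 2%:R * x.
  by transitivity ((z + w) - (z - w)); [ring|rewrite -e1 -e2; ring].
by apply: mulfI; rewrite pnatr_eq0.
Qed.

(** Swapping the indices within both pairs conjugates every coefficient of a Hermitian-preserving
    map, so this reindexing shows the sum equal to its conjugate. *)
Lemma cdot_real Phi Psi : in_H Phi -> in_H Psi -> cdot Phi Psi = (dot Phi Psi)%:C.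
Proof.
move=> h1 h2.
pose sw (q : quad d) : quad d := ((q.1.2, q.1.1), (q.2.2, q.2.1)).
have hsw Th q : in_H Th -> ent Th (sw q) = conjc (ent Th q).
  move=> h; rewrite /ent /sw /= -[in RHS]adjmxE -herm_preserving_adjmx //.
  congr (Th _ _ _); apply/matrixP => a b; rewrite !mxE andbC.
  by rewrite rmorph_nat.
have swK : involutive sw by move=> [[? ?] [? ?]].
have : conjc (cdot Phi Psi) = cdot Phi Psi.
  rewrite [RHS](reindex sw) /=; last exact/onW_bij/inv_bij.
  rewrite rmorph_sum; apply: eq_bigr => q _; rewrite /= !hsw // rmorphM /=.
  by rewrite conjcK.
rewrite /dot; case: (cdot _ _) => x y /= [/eqP]; rewrite eq_sym -addr_eq0 -mulr2n mulrn_eq0 /=.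
by move/eqP ->.
Qed.

Lemma choiE Phi (i j a b : 'I_d) :
  choi Phi (mxtens_index (i, a)) (mxtens_index (j, b)) = d%:R^-1 * ent Phi ((i, j), (a, b)).
Proof.
rewrite mxE; congr (_ * _); rewrite pair_bigA summxE (bigD1 (i, j)) //= tensmxE mxE !eqxx mul1r.
rewrite big1 ?addr0 // => -[i' j'] /= ne; rewrite tensmxE mxE.
rewrite eq_sym (eq_sym j); move: ne; rewrite xpair_eqE => /negbTE ->.
by rewrite mul0r.
Qed.

Lemma hs_ip_cdot Phi Psi : hs_ip Phi Psi = d%:R^-1 ^+ 2 * cdot Phi Psi.
Proof.
rewrite /hs_ip /mxtrace; under eq_bigr do rewrite mxE.
rewrite exchange_big pair_bigA /=.
pose f (q : quad d) : 'I_(d * d) * 'I_(d * d) :=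
  (mxtens_index (q.1.1, q.2.1), mxtens_index (q.1.2, q.2.2)).
pose g (xy : 'I_(d * d) * 'I_(d * d)) : quad d :=
  let u := mxtens_unindex xy.1 in let v := mxtens_unindex xy.2 in ((u.1, v.1), (u.2, v.2)).
have fg : cancel f g by move=> [[i j] [a b]]; rewrite /f /g; cbn [fst snd]; rewrite !mxtens_indexK.
have gf : cancel g f.
  move=> [x y]; rewrite /f /g; cbn [fst snd]; congr (_, _).
    by rewrite -[RHS]mxtens_unindexK; case: (mxtens_unindex x).
  by rewrite -[RHS]mxtens_unindexK; case: (mxtens_unindex y).
rewrite (reindex f) /=; last by apply: onW_bij; exists g.
rewrite mulr_sumr; apply: eq_bigr => -[[i j] [a b]] _.
by rewrite adjmxE /f /= !choiE rmorphM /= fmorphV rmorph_nat; ring.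
Qed.

Lemma hs_ip_dot Phi Psi : in_H Phi -> in_H Psi ->
  hs_ip Phi Psi = ((d%:R^-1) ^+ 2 * dot Phi Psi)%:C.
Proof.
by move=> h1 h2; rewrite hs_ip_cdot cdot_real // rmorphM rmorphXn fmorphV rmorph_nat.
Qed.

Lemma in_H_id : in_H (@id 'M[R[i]]_d).
Proof. by split=> [a X Y|X]. Qed.

Lemma in_H_Ad (U : 'M[R[i]]_d) : in_H (Ad U).
Proof.
split; first exact: Ad_linear.
by move=> X hX; rewrite /Ad !adjmx_mul adjmxK hX mulmxA.
Qed.

Lemma in_H_DZ Phi Psi (a : R) : in_H Phi -> in_H Psi -> in_H (fun X => Phi X + a%:C *: Psi X).
Proof.
move=> [h1 h2] [k1 k2]; split.
  by move=> c X Y; rewrite h1 k1 !scalerDr !scalerA addrACA (mulrC c).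
move=> X hX; apply/matrixP => x y; rewrite adjmxE !mxE rmorphD rmorphM /= oppr0.
by rewrite -[in RHS](h2 X hX) -[in RHS](k2 X hX) !adjmxE.
Qed.

(** The completely depolarizing map. *)
Definition depol X : 'M[R[i]]_d := (d%:R^-1 * \tr X) *: 1%:M.

Lemma depol_linear : linear_map depol.
Proof. by move=> a X Y; rewrite /depol linearD linearZ /= mulrDr scalerDl scalerA mulrCA. Qed.

Lemma tr_adjmx X : \tr (adjmx X) = conjc (\tr X).
Proof. by rewrite /mxtrace rmorph_sum; apply: eq_bigr => k _; rewrite adjmxE. Qed.

Lemma in_H_depol : in_H depol.
Proof.
split; first exact: depol_linear.
move=> X hX; apply/matrixP => x y; rewrite adjmxE !mxE !rmorphM /= fmorphV !rmorph_nat.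
by rewrite -tr_adjmx hX eq_sym.
Qed.

(** [depol] kills the off-diagonal matrix units and sends each diagonal one to [1/d] times the
    identity; the diagonal units add up to the identity matrix. *)
Lemma dot_depol Phi : linear_map Phi -> dot depol Phi = d%:R^-1 * Re (\tr (Phi 1%:M)).
Proof.
move=> hl; rewrite /dot cdot_trace.
have -> : \sum_(p : 'I_d * 'I_d) \tr (adjmx (depol (delta_mx p.1 p.2)) *m Phi (delta_mx p.1 p.2))
   = d%:R^-1 * \tr (Phi 1%:M).
  rewrite -(pair_bigA _ (fun i j => \tr (adjmx (depol (delta_mx i j)) *m Phi (delta_mx i j)))) /=.
  have -> : (1%:M : 'M[R[i]]_d) = \sum_i delta_mx i i.
    apply/matrixP => a b; rewrite mxE summxE (bigD1 a) //= mxE eqxx /=.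
    rewrite big1 ?addr0 1?eq_sym // => k ka; rewrite mxE eq_sym (negbTE ka) //.
  rewrite linear_map_sum // raddf_sum mulr_sumr; apply: eq_bigr => i _.
  have adep (z : R[i]) : adjmx (z *: 1%:M : 'M[R[i]]_d) = conjc z *: 1%:M.
    by apply/matrixP => a b; rewrite adjmxE !mxE rmorphM rmorph_nat eq_sym.
  have trd j : \tr (delta_mx i j : 'M[R[i]]_d) = (i == j)%:R.
    rewrite /mxtrace (bigD1 i) //= mxE eqxx big1 ?addr0 // => k ki.
    by rewrite mxE (negbTE ki).
  rewrite (bigD1 i) //= big1 => [|j ji]; rewrite /depol adep trd.
    by rewrite eqxx mulr1 -scalemxAl mul1mx linearZ /= fmorphV rmorph_nat addr0.
  by rewrite eq_sym (negbTE ji) mulr0 rmorph0 scale0r mul0mx linear0.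
have -> : d%:R^-1 = (d%:R^-1)%:C :> R[i] by rewrite fmorphV rmorph_nat.
by case: (\tr _) => x y /=; rewrite mul0r subr0.
Qed.

Lemma cdot_id : cdot id id = (d%:R ^+ 2 : R[i]).
Proof.
rewrite cdot_trace -(pair_bigA _ (fun i j => \tr (adjmx (delta_mx i j) *m delta_mx i j : 'M[R[i]]_d))) /=.
rewrite (eq_bigr (fun=> d%:R)); last first.
  move=> i _; rewrite (eq_bigr (fun=> 1)) ?sumr_const ?card_ord // => j _.
  have -> : adjmx (delta_mx i j) = delta_mx j i :> 'M[R[i]]_d.
    by apply/matrixP => a b; rewrite adjmxE !mxE rmorph_nat andbC.
  rewrite mul_delta_mx /mxtrace (bigD1 j) //= mxE eqxx big1 ?addr0 // => k ki.
  by rewrite mxE (negbTE ki).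
by rewrite sumr_const card_ord -[LHS]mulr_natr expr2.
Qed.

Lemma cdot_Ad (U : 'M[R[i]]_d) : unitary_mx U -> cdot (Ad U) (Ad U) = cdot id id.
Proof.
move=> [u1 u2]; rewrite !cdot_trace; apply: eq_bigr => p _.
rewrite /Ad !adjmx_mul adjmxK !mulmxA mxtrace_mulC !mulmxA u2 mul1mx.
by rewrite -(mulmxA _ U) u2 mulmx1.
Qed.

Lemma dot_id : dot id id = d%:R ^+ 2.
Proof. by rewrite /dot cdot_id -(rmorph_nat (real_complex R)) -rmorphXn. Qed.

(** [Ad U] and [id] have equal norm, so the claim is the nonnegativity of the squared norm of
    [Ad U - id]. *)
Lemma dot_id_Ad_le (U : 'M[R[i]]_d) : unitary_mx U -> dot id (Ad U) <= dot id id.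
Proof.
move=> hU; have := dot_ge0 (fun X => Ad U X - id X).
rewrite dotBr !dotBl {1}/dot cdot_Ad // -/(dot _ _) (dotC (Ad U)).
by move=> h; lra.
Qed.

End InnerProduct.

(** * Averaging over signed cyclic shifts *)

Section Twirl.
Variables (R : realType) (n : nat).
Local Notation d := n.+1.

(** A diagonal sign matrix times a cyclic permutation. Addition in ['I_d] is modulo [d], hence the
    successor dimension. This finite family serves in place of Haar measure on the unitary group. *)
Definition signed_shift (s : {ffun 'I_d -> bool}) (k : 'I_d) : 'M[R[i]]_d :=
  \matrix_(x, a) if a == x + k then (-1) ^+ s x else 0.

Lemma Ad_signed_shift s k X a b : Ad (signed_shift s k) X a b =
  (-1) ^+ s (a - k) * (-1) ^+ s (b - k) * X (a - k) (b - k).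
Proof.
have sh (c x : 'I_d) : (c == x + k) = (x == c - k) by rewrite eq_sym -subr_eq opprK.
rewrite /Ad mxE (bigD1 (b - k)) //= big1 ?addr0; last first.
  by move=> y yb; rewrite [signed_shift _ _ _ _]mxE sh (negbTE yb) mulr0.
rewrite mxE (bigD1 (a - k)) //= big1 ?addr0; last first.
  by move=> y yb; rewrite adjmxE mxE sh (negbTE yb) conjc0 mul0r.
rewrite adjmxE !mxE !sh !eqxx rmorphXn rmorphN1; ring.
Qed.

Lemma signed_shift_unitary s k : unitary_mx (signed_shift s k).
Proof.
have h : adjmx (signed_shift s k) *m signed_shift s k = 1%:M.
  have := Ad_signed_shift s k 1%:M; rewrite /Ad mulmx1 => h.
  apply/matrixP => a b; rewrite h !mxE (inj_eq (addIr _)).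
  by case: eqP => [->|_]; rewrite ?mulr0 // mulr1 -expr2 sqrr_sign.
by split=> //; exact: mulmx1C.
Qed.

(** For [x] different from [y], flipping the sign at [x] is an involution that negates every
    term. *)
Lemma sum_sign (x y : 'I_d) :
  \sum_(s : {ffun 'I_d -> bool}) (-1) ^+ s x * (-1) ^+ s y = #|{ffun 'I_d -> bool}|%:R * (x == y)%:R :> R[i].
Proof.
case: eqP => [->|xy].
  by under eq_bigr do rewrite -expr2 sqrr_sign; rewrite sumr_const mulr1.
rewrite mulr0; set S := \sum_s _.
pose f (s : {ffun 'I_d -> bool}) : {ffun 'I_d -> bool} := [ffun z => (z == x) (+) s z].
have fK : involutive f by move=> s; apply/ffunP => z; rewrite !ffunE addbA addbb.
have : S = - S.
  rewrite {1}/S (reindex f) /=; last exact/onW_bij/inv_bij.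
  rewrite /S -sumrN; apply: eq_bigr => s _; rewrite !ffunE eqxx.
  have -> : (y == x) = false by apply/eqP => e; apply: xy.
  by rewrite addTb addFb signrN mulNr.
move=> /eqP; rewrite -addr_eq0 -mulr2n mulrn_eq0 /= => /eqP //.
Qed.

(** The sum over signs removes the off-diagonal entries, and the sum over shifts turns each diagonal
    entry into the trace. *)
Lemma twirl X : \sum_(sk : {ffun 'I_d -> bool} * 'I_d) Ad (signed_shift sk.1 sk.2) X =
  #|{: {ffun 'I_d -> bool} * 'I_d}|%:R *: depol X.
Proof.
rewrite -(pair_bigA _ (fun s k => Ad (signed_shift s k) X)) exchange_big /=.
apply/matrixP => a b; rewrite summxE.
rewrite (eq_bigr (fun k => #|{ffun 'I_d -> bool}|%:R * (a == b)%:R * X (a - k) (b - k))); last first.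
  move=> k _; rewrite summxE; under eq_bigr do rewrite Ad_signed_shift.
  by rewrite -mulr_suml sum_sign (inj_eq (addIr _)).
rewrite -mulr_sumr !mxE card_prod card_ord natrM.
have d0 : d%:R != 0 :> R[i] by rewrite pnatr_eq0.
case: eqP => [<-|_]; last by rewrite !mulr0 mul0r.
have -> : \sum_k X (a - k) (a - k) = \tr X.
  rewrite /mxtrace [RHS](reindex (fun k => a - k)) //=.
  by apply: onW_bij; apply: inv_bij => k; rewrite opprB addrC subrK.
by rewrite !mulr1 mulrA -(mulrA _ d%:R) divff // mulr1.
Qed.

End Twirl.

(** * Duality between the closed cone and [in_D] *)

Section Duality.
Variables (R : realType) (d : nat).
Implicit Types (X Y : 'M[R[i]]_d) (G K L P Phi Psi : 'M[R[i]]_d -> 'M[R[i]]_d).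

Lemma cone_add K (U : 'M[R[i]]_d) (s : R) : in_unitary_cone K -> unitary_mx U -> 0 <= s ->
  in_unitary_cone (fun X => K X + s%:C *: (Ad U X - X)).
Proof.
move=> [l [c [V [h1 [h2 h3]]]]] hU s0.
exists l.+1, (fun j => if unlift ord0 j is Some k then c k else s).
exists (fun j => if unlift ord0 j is Some k then V k else U).
split; first by move=> j; case: unliftP.
split; first by move=> j; case: unliftP.
move=> X; rewrite big_ord_recl unlift_none addrC h3; congr (_ + _).
by apply: eq_bigr => j _; rewrite liftK.
Qed.

Lemma cone_scale K (s : R) : in_unitary_cone K -> 0 <= s ->
  in_unitary_cone (fun X => s%:C *: K X).
Proof.
move=> [l [c [V [h1 [h2 h3]]]]] s0; exists l, (fun j => s * c j), V.
split; first by move=> j; rewrite mulr_ge0.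
split=> // X; rewrite h3 scaler_sumr; apply: eq_bigr => j _.
by rewrite scalerA rmorphM.
Qed.

Lemma cone0 : in_unitary_cone (fun _ : 'M[R[i]]_d => 0).
Proof.
exists 0%N, (fun=> 0), (fun=> 1%:M); split=> //; split=> [[]|X] //.
by rewrite big_ord0.
Qed.

Lemma cone_in_H K : in_unitary_cone K -> in_H K.
Proof.
move=> hK; split; first exact: cone_linear.
move: hK => [l [c [U [_ [_ h]]]]] X hX; rewrite h.
apply/matrixP => a b; rewrite adjmxE !summxE rmorph_sum; apply: eq_bigr => j _.
have [_ /(_ X hX)] := in_H_Ad (U j); move: (Ad _ _) => Y hY.
rewrite !mxE rmorphM rmorphB /= oppr0.
by rewrite -[in RHS]hX -[in RHS]hY !adjmxE.
Qed.

Lemma cone_unital K : in_unitary_cone K -> K 1%:M = 0.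
Proof.
move=> [l [c [U [_ [hU h]]]]]; rewrite h big1 // => j _.
by rewrite /Ad mulmx1; have [-> _] := hU j; rewrite subrr scaler0.
Qed.

Lemma cone_trace K X : in_unitary_cone K -> \tr (K X) = 0.
Proof.
move=> [l [c [U [_ [hU h]]]]]; rewrite h raddf_sum big1 // => j _ /=.
rewrite linearZ /= linearB /= /Ad mxtrace_mulC mulmxA.
by have [_ ->] := hU j; rewrite mul1mx subrr mulr0.
Qed.

Lemma dot_cone_ge0 G K : in_unitary_cone K ->
  (forall U : 'M[R[i]]_d, unitary_mx U -> dot G id <= dot G (Ad U)) -> 0 <= dot G K.
Proof.
move=> [l [c [U [hc [hU h]]]]] hG.
rewrite (_ : K = fun X => \sum_j (c j)%:C *: (Ad (U j) X - X)); last exact/funext.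
rewrite (dot_sumr G c (fun j X => Ad (U j) X - X)).
apply: sumr_ge0 => j _; rewrite mulr_ge0 //.
by rewrite (dotBr G (Ad (U j)) id) subr_ge0 hG.
Qed.

Lemma dot_le_opn Phi Psi : `|dot Phi Psi| <= opn Phi * opn Psi.
Proof.
apply: le_trans (ge_normc_Re _) _; apply: le_trans (normc_sum _ _ _) _.
rewrite mulr_suml; apply: ler_sum => q _; rewrite normcM.
have -> : normc (conjc (ent Phi q)) = normc (ent Phi q).
  by case: (ent Phi q) => a b /=; rewrite sqrrN.
rewrite ler_wpM2l ?normc_ge0 // /opn (bigD1 q) //= lerDl.
by apply: sumr_ge0 => p _; exact: normc_ge0.
Qed.

(** As [G] is orthogonal to [id], it pairs nonnegatively with every [Ad U - id], hence with the
    cone, and by approximation with [L]. *)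
Lemma closed_cone_dual L G : (0 < d)%N -> in_H L -> in_closed_unitary_cone L ->
  in_D G -> 0 <= hs_ip G L.
Proof.
move=> d0 hL hc [[hG _] [hid hAd]].
have dp : 0 < (d%:R^-1 : R) ^+ 2 by rewrite exprn_gt0 // invr_gt0 ltr0n.
rewrite hs_ip_dot // ler0c pmulr_rge0 //.
have dG U : unitary_mx U -> dot G id <= dot G (Ad U).
  move=> hU; have := hAd U hU; rewrite hs_ip_dot //; last exact: in_H_Ad.
  rewrite ler0c pmulr_rge0 // dotC; apply: le_trans.
  move: hid; rewrite hs_ip_dot //; last exact: in_H_id.
  by move=> /complexI/eqP; rewrite mulf_eq0 gt_eqF //= dotC => /eqP ->.
apply/ler_addgt0Pr => e e0.
have oG : 0 < opn G + 1 by rewrite ltr_wpDl ?opn_ge0.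
have [K [K1 K2]] := closed_cone_approx hc (divr_gt0 e0 oG).
have := dot_le_opn G (fun X => L X - K X); rewrite dotBr => h.
have h2 : `|dot G L - dot G K| <= e.
  apply: le_trans h _; move: K2; rewrite ler_pdivlMr // => K2; apply: le_trans K2.
  by rewrite mulrC ler_wpM2l ?opn_ge0 // lerDl.
have := dot_cone_ge0 K1 dG; move: h2; rewrite ler_norml => /andP[]; lra.
Qed.

Lemma entB Phi Psi q : ent (fun X => Phi X - Psi X) q = ent Phi q - ent Psi q.
Proof. by rewrite /ent !mxE. Qed.

Lemma dot_lim (F : set_system nat) (Phin Psin : nat -> 'M[R[i]]_d -> 'M[R[i]]_d) Phi Psi :
  Filter F -> (forall q, clim F (fun n => ent (Phin n) q) (ent Phi q)) ->
  (forall q, clim F (fun n => ent (Psin n) q) (ent Psi q)) ->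
  (fun n => dot (Phin n) (Psin n)) @ F --> dot Phi Psi.
Proof.
move=> FF h1 h2.
have [h _] : clim F (fun n => cdot (Phin n) (Psin n)) (cdot Phi Psi).
  by apply: clim_sum => q _; apply: climM => //; exact: climJ.
exact: h.
Qed.

(** First-order condition at an endpoint: divide by [s] and let [s] be small. *)
Lemma quadratic_ge0 (x y : R) : (forall s, 0 < s <= 1 -> 0 <= 2 * s * x + s ^+ 2 * y) -> 0 <= x.
Proof.
move=> h; rewrite leNgt; apply/negP => x0.
have y1 : 0 < `|y| + 1 - x by rewrite -addrA ltr_wpDl // subr_gt0 (lt_trans x0).
(* If [x < 0], this [s] lies in the allowed range and satisfies [s * y <= - x], so
   [2 x + s y <= x < 0]. *)
set s := - x / (`|y| + 1 - x).
have s0 : 0 < s by rewrite divr_gt0 // oppr_gt0.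
have s1 : s <= 1 by rewrite ler_pdivrMr // mul1r lerDr addr_ge0.
have := h s; rewrite s0 s1 => /(_ isT).
rewrite expr2 -mulrA mulrCA -mulrA -mulrDr pmulr_rge0 // => hs.
have sy : s * y <= - x.
  apply: (@le_trans _ _ (s * (`|y| + 1 - x))); last by rewrite divfK // gt_eqF.
  rewrite ler_wpM2l ?(ltW s0) //; have := ler_norm y; lra.
lra.
Qed.

(** A minimizing sequence is optimal only up to [1/(n+1)]; this slack disappears along any filter
    refining [\oo]. *)
Lemma lim_slack_ge0 (F : set_system nat) (z : nat -> R) (l : R) : ProperFilter F -> \oo `<=` F ->
  z @ F --> l -> (forall n, - n.+1%:R^-1 <= z n) -> 0 <= l.
Proof.
move=> PF hF hz h.
have hh : (fun n => z n + n.+1%:R^-1 : R) @ F --> l + 0.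
  apply: cvgD => //; have := @cvg_harmonic R; apply: cvg_trans.
  by move=> A; exact: hF.
rewrite -[l]addr0; apply: (cvgr_to_ge hh); apply: nearW => n.
by have := h n; rewrite -subr_ge0 opprK.
Qed.

(* [P] is the point of the closed cone nearest to [L]; it is reached along an ultrafilter
   from a minimizing sequence, and [P - L] supports the cone by the usual variational argument. *)
Lemma cone_separation L (del : R) : in_H L -> 0 < del ->
  (forall K, in_unitary_cone K -> del <= dot (fun X => K X - L X) (fun X => K X - L X)) ->
  exists P, [/\ in_H P, P 1%:M = 0, (forall X, \tr (P X) = 0),
    (forall U, unitary_mx U ->
       dot (fun X => P X - L X) id <= dot (fun X => P X - L X) (Ad U)) &
    dot (fun X => P X - L X) L < 0].
Proof.
move=> hL del0 hdel.
pose nd K := dot (fun X => K X - L X) (fun X => K X - L X).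
pose S : set R := [set nd K | K in [set K | in_unitary_cone K]].
have hS : has_inf S.
  split; first by exists (nd (fun=> 0)), (fun=> 0) => //; exact: cone0.
  by exists 0 => _ [K _ <-]; exact: dot_ge0.
pose m := inf S.
have mle K : in_unitary_cone K -> m <= nd K.
  by move=> hK; apply: ge_inf; [have [] := hS|exists K].
have delm : del <= m.
  by apply: lb_le_inf; [have [] := hS|move=> _ [K hK <-]; exact: hdel].
have /choice[Kn hKn] : forall n : nat, exists K, in_unitary_cone K /\ nd K < m + n.+1%:R^-1.
  move=> n; have n0 : 0 < n.+1%:R^-1 :> R by rewrite invr_gt0.
  by have [_ [K hK <-] hlt] := inf_adherent n0 hS; exists K.
have [F [UF hF]] := ultraFilterLemma (eventually_filter : ProperFilter \oo).
have PF : ProperFilter F by exact: ultra_proper.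
have FF : Filter F by exact: PF.
have hc n : in_unitary_cone (Kn n) by have [] := hKn n.
have /choice[p hp] : forall q : quad d, exists l, clim F (fun n => ent (Kn n) q) l.
  (* The squared modulus of a coefficient of [Kn n - L] is below [m + 1], so its modulus is at most
     [m + 2]. *)
  move=> q; apply: (@clim_bounded _ _ _ (normc (ent L q) + (m + 2))) => n.
  have -> : ent (Kn n) q = ent L q + ent (fun X => Kn n X - L X) q.
    by rewrite entB addrC subrK.
  apply: le_trans (le_normcD _ _) _; rewrite lerD2l.
  have h1 := normc_sqr_le_dot (fun X => Kn n X - L X) q.
  have [_ h2] := hKn n.
  have h3 : n.+1%:R^-1 <= 1 :> R by rewrite invf_le1 ?ler1n ?ltr0n.
  have h4 := normc_ge0 (ent (fun X => Kn n X - L X) q).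
  move: h1 h2 h4; rewrite -/(nd _); move: (normc _) (nd _) (n.+1%:R^-1 : R) h3 => x y z *; nra.
pose P X : 'M[R[i]]_d := \matrix_(a, b) \sum_r X r.1 r.2 * p (r, (a, b)).
have hP X : mclim F (fun n => Kn n X) (P X).
  move=> a b; rewrite mxE.
  rewrite (_ : (fun k => _) = fun n => \sum_r X r.1 r.2 * ent (Kn n) (r, (a, b))); last first.
    by apply/funext => n; rewrite (linear_mapE (cone_linear (hc n))).
  by apply: clim_sum => r _; apply: climM => //; exact: clim_cst.
have Pent q : clim F (fun n => ent (Kn n) q) (ent P q) by exact: hP.
have PH : in_H P.
  split.
    move=> a X Y; apply: (mclim_uniq (F := F) (u := fun n => Kn n (a *: X + Y))) => //.
    move=> x y; rewrite 2!mxE.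
    rewrite (_ : (fun k => _) = fun n => a * Kn n X x y + Kn n Y x y); last first.
      by apply/funext => n; rewrite (cone_linear (hc n)) 2!mxE.
    by apply: climD; [apply: climM; [exact: clim_cst|exact: hP]|exact: hP].
  move=> X hX; apply: (mclim_uniq (F := F) (u := fun n => Kn n X)) => //.
  rewrite (_ : (fun n => Kn n X) = fun n => adjmx (Kn n X)); first exact: mclimJ.
  by apply/funext => n; have [_ ->] := cone_in_H (hc n).
exists P; split=> //.
- apply: (mclim_uniq (F := F) (u := fun n => Kn n 1%:M)) => //.
  rewrite (_ : (fun n => Kn n 1%:M) = fun=> 0); first exact: mclim_cst.
  by apply/funext => n; exact: cone_unital.
- move=> X; apply: (@clim_uniq _ F (fun n => \tr (Kn n X))).
    by apply: clim_sum => a _; exact: hP.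
  rewrite (_ : (fun n => \tr (Kn n X)) = fun=> 0); first exact: clim_cst.
  by apply/funext => n; exact: cone_trace.
(* Variation in the direction [a]: adding [s a] stays in the cone, so the squared distance cannot
   drop below [m]. *)
- move=> U hU; pose a X := Ad U X - X.
  have D : (fun n => dot (fun X => Kn n X - L X) a) @ F --> dot (fun X => P X - L X) a.
    apply: dot_lim => q; last exact: clim_cst.
    rewrite entB; under eq_fun do rewrite entB.
    by apply: climB; [exact: Pent|exact: clim_cst].
  rewrite -subr_ge0 -(dotBr _ (Ad U) id) -/a; apply: (@quadratic_ge0 _ (dot a a)) => s /andP[s0 s1].
  have hz : (fun n => 2 * s * dot (fun X => Kn n X - L X) a + s ^+ 2 * dot a a) @ F -->
      2 * s * dot (fun X => P X - L X) a + s ^+ 2 * dot a a.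
    by apply: cvgD; [apply: cvgM => //; exact: cvg_cst|exact: cvg_cst].
  apply: lim_slack_ge0 hF hz _ => n.
  have [_ h1] := hKn n; have := mle _ (cone_add (hc n) hU (ltW s0)).
  rewrite /nd (_ : (fun X => _ - L X) = fun X => (Kn n X - L X) + s%:C *: a X); last first.
    by apply/funext => X; rewrite addrAC.
  rewrite dotDZl !dotDZr (dotC a (fun X => Kn n X - L X)); move: h1; rewrite /nd; move: (n.+1%:R^-1 : R) => w; lra.
have DP : (fun n => dot (fun X => Kn n X - L X) (Kn n)) @ F --> dot (fun X => P X - L X) P.
  apply: dot_lim => q //.
  rewrite entB; under eq_fun do rewrite entB.
  by apply: climB; [exact: Pent|exact: clim_cst].
have DD : (fun n => nd (Kn n)) @ F --> nd P.
  have h q : clim F (fun n => ent (fun X => Kn n X - L X) q) (ent (fun X => P X - L X) q).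
    rewrite entB; under eq_fun do rewrite entB.
    by apply: climB; [exact: Pent|exact: clim_cst].
  exact: dot_lim.
have PP : (fun n => dot (Kn n) (Kn n)) @ F --> dot P P by exact: dot_lim.
have h1 : m <= nd P by apply: (cvgr_to_ge DD); apply: nearW => n; exact: mle.
(* Variation along the ray: the factor [1 - s] keeps [Kn n] in the cone for [s <= 1]. *)
have h2 : 0 <= - dot (fun X => P X - L X) P.
  apply: (@quadratic_ge0 _ (dot P P)) => s /andP[s0 s1].
  have hz : (fun n => 2 * s * - dot (fun X => Kn n X - L X) (Kn n) + s ^+ 2 * dot (Kn n) (Kn n)) @ F -->
      2 * s * - dot (fun X => P X - L X) P + s ^+ 2 * dot P P.
    apply: cvgD; apply: cvgM => //; try exact: cvg_cst.
    exact: cvgN.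
  apply: lim_slack_ge0 hF hz _ => n.
  have s1' : 0 <= 1 - s by rewrite subr_ge0.
  have [_ h] := hKn n; have := mle _ (cone_scale (hc n) s1').
  rewrite /nd (_ : (fun X => _ - L X) = fun X => (Kn n X - L X) + (- s)%:C *: Kn n X); last first.
    by apply/funext => X; rewrite rmorphB rmorph1 rmorphN scalerBl scale1r scaleNr addrAC.
  rewrite dotDZl !dotDZr (dotC (Kn n) (fun X => Kn n X - L X)); move: h; rewrite /nd; move: (n.+1%:R^-1 : R) => w; lra.
(* The squared distance is [<P - L, P> - <P - L, L>]. It is at least [m > 0] while the first term is
   at most 0, so [<P - L, L>] is negative. *)
move: h1; rewrite /nd {1}dotBr; lra.
Qed.

(* A separating functional is moved into [in_D] by adding a little of [depol - id], which makes its
   value at [id] strictly negative, and then rescaling and adding [depol] to normalize that value to 0. *)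
Lemma dual_witness L P : (1 < d)%N -> in_H L -> L 1%:M = 0 -> (forall X, \tr (L X) = 0) ->
  in_H P -> P 1%:M = 0 -> (forall X, \tr (P X) = 0) ->
  dot P id <= 0 -> (forall U, unitary_mx U -> dot P id <= dot P (Ad U)) -> dot P L < 0 ->
  exists G, in_D G /\ dot G L < 0.
Proof.
move=> d1 hL L1 Ltr hP P1 Ptr Pid PAd PL.
have d0 : d%:R != 0 :> R by rewrite pnatr_eq0 -lt0n ltnW.
have dC : (d%:R : R[i]) != 0 by rewrite pnatr_eq0 -lt0n ltnW.
have RetrE : Re (\tr (1%:M : 'M[R[i]]_d)) = d%:R.
  by rewrite mxtrace1 -(rmorph_nat (real_complex R)).
have dep_id : dot (@depol R d) id = 1.
  by rewrite dot_depol ?in_H_id.1 // RetrE mulVf.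
have dep_Ad U : unitary_mx U -> dot (@depol R d) (Ad U) = 1.
  move=> [hU _]; rewrite dot_depol; last exact: Ad_linear.
  by rewrite /Ad mulmx1 hU RetrE mulVf.
have dep_L : dot (@depol R d) L = 0 by rewrite dot_depol ?L1 ?linear0 ?mulr0 //; exact: hL.1.
pose G1 X := depol X - X.
have G1B Phi : dot G1 Phi = dot (@depol R d) Phi - dot id Phi by exact: (dotBl Phi (@depol R d) id).
have G1H : in_H G1.
  have := in_H_DZ (-1) (in_H_depol R d) (in_H_id R d).
  by rewrite (_ : (fun X => _) = G1) //; apply/funext => X; rewrite rmorphN1 scaleN1r.
(* Chosen so that the perturbation uses at most half of the negative value [dot P L]. *)
pose e := - dot P L / (2 * (`|dot G1 L| + 1)).
have e0 : 0 < e by rewrite divr_gt0 ?oppr_gt0 // mulr_gt0 // ltr_wpDl.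
have eL : dot P L + e * dot G1 L < 0.
  have h : e * (`|dot G1 L| + 1) = - dot P L / 2.
    by rewrite /e; field; rewrite gt_eqF // ltr_wpDl.
  have : e * dot G1 L <= e * (`|dot G1 L| + 1).
    by rewrite ler_wpM2l ?(ltW e0) //; have := ler_norm (dot G1 L); lra.
  rewrite h; lra.
pose G2 X := P X + e%:C *: G1 X.
have G2H : in_H G2 by exact: in_H_DZ.
have G2E Phi : dot G2 Phi = dot P Phi + e * (dot (@depol R d) Phi - dot id Phi).
  by rewrite -G1B; exact: dotDZl.
(* At [id] the perturbation contributes [e (1 - d^2)], which is negative because [d > 1]. *)
have G2id : dot G2 id < 0.
  rewrite G2E dep_id dot_id.
  have : 1 < d%:R ^+ 2 :> R by rewrite exprn_egt1 // ltr1n.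
  by move=> h; apply: ltr_wnDl => //; rewrite pmulr_rlt0 // subr_lt0.
(* [depol] takes the same value 1 at [id] and at every [Ad U], while [dot id] is largest at [id];
   the perturbation therefore preserves the inequality. *)
have G2Ad U : unitary_mx U -> dot G2 id <= dot G2 (Ad U).
  move=> hU; rewrite !G2E dep_id dep_Ad //; apply: lerD; first exact: PAd.
  by rewrite ler_wpM2l ?(ltW e0) // lerD2l lerN2 dot_id_Ad_le.
(* This scaling gives [s * dot G2 id = -1], cancelling the value 1 of [depol] at [id]. *)
pose s := - (dot G2 id)^-1.
have s0 : 0 < s by rewrite oppr_gt0 invr_lt0.
pose G X := depol X + s%:C *: G2 X.
have GE Phi : dot G Phi = dot (@depol R d) Phi + s * dot G2 Phi by exact: dotDZl.
have GH : in_H G by apply: in_H_DZ => //; exact: in_H_depol.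
have sid : s * dot G2 id = -1 by rewrite mulNr mulVf // lt_eqF.
have Gid : dot id G = 0 by rewrite dotC GE dep_id sid subrr.
have dep1 : depol 1%:M = 1%:M :> 'M[R[i]]_d by rewrite /depol mxtrace1 mulVf // scale1r.
have deptr X : \tr (depol X) = \tr X.
  by rewrite /depol linearZ /= mxtrace1 mulrAC mulVf // mul1r.
exists G; split; last by rewrite GE dep_L add0r pmulr_rlt0 // G2E -G1B.
split; first split=> //.
  split; first by rewrite /G /G2 /G1 P1 dep1 subrr scaler0 addr0 scaler0 addr0.
  have trDZ A B (a : R[i]) : \tr (A + a *: B : 'M[R[i]]_d) = \tr A + a * \tr B.
    by rewrite linearD linearZ.
  have trB A B : \tr (A - B : 'M[R[i]]_d) = \tr A - \tr B by rewrite linearB.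
  by move=> X; rewrite /G trDZ /G2 trDZ /G1 trB Ptr deptr subrr mulr0 addr0 mulr0 addr0.
split; first by rewrite hs_ip_dot ?Gid ?mulr0 //; exact: in_H_id.
move=> U hU; rewrite hs_ip_dot //; last exact: in_H_Ad.
rewrite ler0c mulr_ge0 ?exprn_ge0 ?invr_ge0 // dotC GE dep_Ad // -[1]opprK -sid -mulNr addrC mulNr subr_ge0.
by rewrite ler_wpM2l ?(ltW s0) // G2Ad.
Qed.

End Duality.

(** * Separation and averaging combined in positive dimension *)

(** Summing the hypothesis over all signed shifts turns the right side into a multiple of
    [dot P depol], which vanishes because [P] sends the identity to 0. *)
Lemma dot_id_le0 (R : realType) (n : nat) (P : 'M[R[i]]_n.+1 -> 'M[R[i]]_n.+1) :
  in_H P -> P 1%:M = 0 -> (forall U, unitary_mx U -> dot P id <= dot P (Ad U)) -> dot P id <= 0.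
Proof.
move=> hP P1 h.
pose I := ({ffun 'I_n.+1 -> bool} * 'I_n.+1)%type.
have hI : 0 < #|{: I}|%:R :> R.
  by rewrite ltr0n; apply/card_gt0P; exists ([ffun=> false], 0).
have : \sum_(sk : I) dot P id <= \sum_(sk : I) 1 * dot P (Ad (signed_shift R sk.1 sk.2)).
  by apply: ler_sum => sk _; rewrite mul1r; apply: h; exact: signed_shift_unitary.
rewrite -(dot_sumr P (fun=> 1) (fun sk : I => Ad (signed_shift R sk.1 sk.2))).
rewrite (_ : (fun X => \sum_(sk : I) (1 : R)%:C *: Ad (signed_shift R sk.1 sk.2) X) =
    fun X => 0 + (#|{: I}|%:R : R)%:C *: depol X); last first.
  apply/funext => X; rewrite add0r rmorph_nat -twirl; apply: eq_bigr => sk _.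
  by rewrite scale1r.
have P0 : dot P (@depol R n.+1) = 0.
  by rewrite dotC dot_depol ?P1 ?linear0 ?mulr0 //; exact: hP.1.
rewrite (dotDZr P (fun=> 0)) P0 mulr0 addr0.
have -> : dot P (fun=> 0) = 0.
  by rewrite dotE big1 // => q _; rewrite /ent !mxE /= !mulr0 addr0.
by rewrite sumr_const -mulr_natr pmulr_lle0.
Qed.

Lemma dual_closed_cone (R : realType) (n : nat) (L : 'M[R[i]]_n.+1 -> 'M[R[i]]_n.+1) :
  in_H L -> L 1%:M = 0 -> (forall X, \tr (L X) = 0) ->
  (forall G, in_D G -> 0 <= hs_ip G L) -> in_closed_unitary_cone L.
Proof.
move=> hL L1 Ltr h; have lL : linear_map L by exact: hL.1.
apply: approx_closed_cone => // e e0; apply: contrapT => hno.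
(* In dimension 1 the only matrix unit is the identity, so [L] vanishes there and the zero element
   of the cone already approximates it. *)
have hd : (1 < n.+1)%N.
  rewrite ltnS lt0n; apply/eqP => n0; apply: hno; exists (fun=> 0); split; first exact: cone0.
  rewrite (_ : opn _ = 0) ?(ltW e0) //; apply: big1 => q _; rewrite /ent subr0.
  have -> : delta_mx q.1.1 q.1.2 = 1%:M :> 'M[R[i]]_n.+1.
    apply/matrixP => a b; rewrite !mxE.
    have all0 (x y : 'I_n.+1) : x = y.
      by move: x y; rewrite n0 => x y; rewrite !ord1.
    by rewrite (all0 a b) (all0 q.1.1 b) (all0 q.1.2 b) !eqxx.
  by rewrite L1 mxE normc0.
(* If the squared distance to [K] were below [c ^+ 2], each coefficient of [L - K] would be below
   [c] and their sum at most [e]. *)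
pose c := e / #|{: quad n.+1}|.+1%:R.
have c0 : 0 < c by rewrite divr_gt0.
have hsep K : in_unitary_cone K -> c ^+ 2 <= dot (fun X => K X - L X) (fun X => K X - L X).
  move=> hK; rewrite leNgt; apply/negP => hlt; apply: hno; exists K; split=> //.
  apply: (@le_trans _ _ (\sum_(q : quad n.+1) c)).
    apply: ler_sum => q _; rewrite /ent mxE [X in _ + X]mxE normcB.
    have := le_lt_trans (normc_sqr_le_dot _ q) hlt; rewrite /ent mxE [X in _ + X]mxE.
    by rewrite ltr_pXn2r ?nnegrE ?normc_ge0 ?(ltW c0) // => /ltW.
  rewrite sumr_const -(mulr_natr c) /c -mulrA ler_piMr ?(ltW e0) //.
  by rewrite mulrC ler_pdivrMr ?mul1r ?ler_nat ?leqnSn.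
have [P [P1 P2 P3 P4 P5]] := cone_separation hL (exprn_gt0 2 c0) hsep.
pose G0 X := P X - L X.
have G0H : in_H G0.
  have := in_H_DZ (-1) P1 hL.
  by rewrite (_ : (fun X => _) = G0) //; apply/funext => X; rewrite rmorphN1 scaleN1r.
have G01 : G0 1%:M = 0 by rewrite /G0 P2 L1 subrr.
have G0tr X : \tr (G0 X) = 0 by rewrite /G0 linearB /= P3 Ltr subrr.
have [G [GD GL]] := dual_witness hd hL L1 Ltr G0H G01 G0tr (dot_id_le0 G0H G01 P4) P4 P5.
have := h G GD; rewrite hs_ip_dot //; last by have [[]] := GD.
rewrite ler0c pmulr_rge0; last by rewrite exprn_gt0 // invr_gt0.
by rewrite leNgt GL.
Qed.

Theorem theorem5p2 (R : realType) (d : nat) (hd : (0 < d)%N)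
  (L : 'M[R[i]]_d -> 'M[R[i]]_d) :
  in_H L -> L 1%:M = 0 -> (forall X, \tr (L X) = 0) ->
  let cond_i := forall t : R, 0 <= t ->
      exists E : 'M[R[i]]_d -> 'M[R[i]]_d, is_expmap L t E /\ mixed_unitary E in
  let cond_ii := in_closed_unitary_cone L in
  let cond_iii := forall G : 'M[R[i]]_d -> 'M[R[i]]_d, in_D G -> 0 <= hs_ip G L in
  (cond_i <-> cond_ii) /\ (cond_ii <-> cond_iii).
Proof.
move=> hL L1 Ltr /=; have lL : linear_map L by exact: hL.1.
split; split.
- exact: semigroup_closed_cone.
- exact: closed_cone_semigroup.
- by move=> hc G; exact: closed_cone_dual.
(* Positive dimension is rewritten as a successor, the form needed for the cyclic shifts. *)
by case: d hd L hL L1 Ltr lL => // n _ L hL L1 Ltr _; exact: dual_closed_cone.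
Qed.
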